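(* Let $(L,q_L)$ be a quadratic lattice of rank $n$ over $\mathfrak{o}$ with $N(L)\subseteq\mathfrak{o}$, and let $k\ge n$. Then \[ \alpha^{prim}(L,H_k)=f^{-(2kn-(n^2+n)/2)}\cdot\#\mathrm{O}^{prim}_{\kappa}(\bar q_L,\bar q_k)(\kappa), \] where $\mathrm{O}^{prim}_{\kappa}(\bar q_L,\bar q_k)(\kappa)$ is the set of injective $\kappa$-linear maps $L/\pi L\to H_k/\pi H_k$ carrying $\bar q_L$ to $\bar q_k$.
   Context: $F$ finite over $\mathbb{Q}_p$, $\mathfrak{o}$ its integers, $\pi$ a uniformizer, $\kappa=\mathfrak{o}/\pi$, $f=\#\kappa$. $(L,q_L)$ is a free $\mathfrak{o}$-module of rank $n$ with quadratic form $q_L:L\to\mathfrak{o}$, $V=L\otimes F$ nondegenerate; $N(L)$ is the fractional ideal generated by $q_L(L)$. $H_k=\mathfrak{o}^{2k}$ with $q_k=\sum_{i=1}^kx_iy_i$, $W_k=H_k\otimes F$; $\bar q_L$, $\bar q_k$ are the reductions mod $\pi$ on $L/\pi L$, $H_k/\pi H_k$. Let $\mathfrak{M}=\mathrm{Hom}_F(V,W_k)$, $\mathfrak{Q}$ the space of quadratic forms on $V$, $\rho:\mathfrak{M}^*\to\mathfrak{Q}$, $m\mapsto q_k\circ m$, on injective maps (a smooth morphism with fiber over $q_L\otimes F$ the variety of isometric embeddings). With translation-invariant top forms $\omega_{\mathfrak{M},L}$, $\omega_{\mathfrak{Q},L}$ normalized so that $\mathrm{Hom}_{\mathfrak{o}}(L,H_k)$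 and the integral quadratic forms on $L$ have volume $1$, let $\omega^{ld}_L$ be the form on the fiber with $\rho^*\omega_{\mathfrak{Q},L}\otimes\omega^{ld}_L=\omega_{\mathfrak{M},L}$. The primitive local density $\alpha^{prim}(L,H_k)$ is $\int|\omega^{ld}_L|$ over the set of $\mathfrak{o}$-linear $\varphi:L\to H_k$ with $q_k\circ\varphi=q_L$ whose reduction mod $\pi$ is injective. *)

(* Defs.v *)
From HB Require Import structures.
From mathcomp Require Import all_boot all_order all_algebra all_field.
From mathcomp Require Import all_classical all_reals all_analysis.

Set Implicit Arguments.
Unset Strict Implicit.
Unset Printing Implicit Defensive.

Import Order.TTheory GRing.Theory Num.Theory.
Local Open Scope classical_set_scope.
Local Open Scope ring_scope.

(** * p-adic fields *)

(* A valuation [v : K -> int] is only meaningful away from 0; [vge v m x]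
   stands for "v x >= m" with the convention v 0 = +oo. *)
Definition vge (K : fieldType) (v : K -> int) (m : int) (x : K) : bool :=
  (x == 0) || (m <= v x).

Record is_valuation (K : fieldType) (v : K -> int) : Prop := IsValuation {
  valuationM : forall x y : K, x != 0 -> y != 0 -> v (x * y) = v x + v y;
  valuationD : forall x y : K, x != 0 -> y != 0 -> x + y != 0 ->
    Num.min (v x) (v y) <= v (x + y) }.

(* (K, v) is the completion of the rationals for the p-adic valuation. *)
Record is_Qp (p : nat) (K : fieldType) (v : K -> int) : Prop := IsQp {
  Qp_valuation : is_valuation v;
  Qp_extends : forall n : nat, (0 < n)%N ->
    (n%:R != 0 :> K) /\ v n%:R = (logn p n)%:Z;
  Qp_dense : forall (x : K) (m : int), exists r : rat, vge v m (x - ratr r);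
  Qp_complete : forall u : nat -> K,
    (forall m : int, exists N : nat, forall i j : nat,
        (N <= i)%N -> (N <= j)%N -> vge v m (u i - u j)) ->
    exists l : K, forall m : int, exists N : nat, forall i : nat,
        (N <= i)%N -> vge v m (u i - l) }.

(* A finite extension F of Q_p with its normalized valuation: the one that has
   value group Z and restricts to a multiple (by the ramification index) of
   the p-adic valuation of Q_p. *)
Record padicField := PadicField {
  pf_p : nat;
  pf_Qp : fieldType;
  pf_vp : pf_Qp -> int;
  pf_F :> fieldExtType pf_Qp;
  pf_v : pf_F -> int;
  pf_prime : prime pf_p;
  pf_is_Qp : is_Qp pf_p pf_vp;
  pf_valuation : is_valuation pf_v;
  pf_normalized : exists2 x : pf_F, x != 0 & pf_v x = 1;
  pf_extends : exists2 e : nat, (0 < e)%N &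
    forall x : pf_Qp, x != 0 -> pf_v (x%:A) = e%:Z * pf_vp x }.

Arguments pf_v {p} : rename.

Section IntegerRing.
Variable K : padicField.

Definition integer : {pred K} := fun x => vge pf_v 0 x.

Lemma pf_v1 : pf_v (1 : K) = 0.
Proof.
have := valuationM (pf_valuation K) (oner_neq0 K) (oner_neq0 K).
by rewrite mulr1 => /esym/eqP; rewrite -subr_eq0 addrK => /eqP.
Qed.

Lemma pf_vN (x : K) : pf_v (- x) = pf_v x.
Proof.
have [->|x0] := eqVneq x 0; first by rewrite oppr0.
have N10 : (- 1 : K) != 0 by rewrite oppr_eq0 oner_neq0.
have vN1 : pf_v (- 1 : K) = 0.
  have := valuationM (pf_valuation K) N10 N10.
  rewrite mulrNN mulr1 pf_v1 -mulr2n => /esym/eqP.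
  by rewrite mulrn_eq0 => /eqP.
by rewrite -mulN1r (valuationM (pf_valuation K)) // vN1 add0r.
Qed.

Lemma integer_subring : subring_closed integer.
Proof.
split=> [|x y|x y]; rewrite /integer !unfold_in /vge.
- by rewrite pf_v1 lexx orbT.
- have [->|x0] := eqVneq x 0; first by rewrite sub0r oppr_eq0 pf_vN.
  have [->|y0] := eqVneq y 0; first by rewrite subr0 (negbTE x0).
  have [//|xy0] := eqVneq (x - y) 0; move=> /= vx vy.
  apply: le_trans (valuationD (pf_valuation K) x0 _ xy0).
    by rewrite pf_vN le_min vx vy.
  by rewrite oppr_eq0.
- have [->|x0] := eqVneq x 0; first by rewrite mul0r eqxx.
  have [->|y0] := eqVneq y 0; first by rewrite mulr0 eqxx.
  move=> /= vx vy.
  by rewrite (valuationM (pf_valuation K)) // addr_ge0 ?orbT.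
Qed.

HB.instance Definition _ :=
  GRing.isSubringClosed.Build _ integer integer_subring.

Record integerRing := IntegerRing { ival : K; _ : ival \in integer }.

HB.instance Definition _ := [isSub for ival].
HB.instance Definition _ := [Choice of integerRing by <:].
HB.instance Definition _ := [SubChoice_isSubComNzRing of integerRing by <:].

End IntegerRing.

(* red exhibits kappa as the residue field o / pi o, pi being a uniformizer. *)
Record is_residue_field (K : padicField) (pi : integerRing K)
    (kappa : fieldType) (red : integerRing K -> kappa) : Prop :=
  IsResidueField {
    uniformizer_neq0 : ival pi != 0;
    uniformizer_val : pf_v (ival pi) = 1;
    residue_surj : forall y : kappa, exists x, red x = y;
    residue_ker : forall x : integerRing K, red x = 0 <-> exists y : integerRing K, x = pi * y }.

(** * Quadratic forms *)

Definition polar (S : nmodType) (T : zmodType) (q : S -> T) (x y : S) : T :=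
  q (x + y) - q x - q y.

Record is_quadratic (S : comNzRingType) (M : lmodType S) (q : M -> S) : Prop :=
  IsQuadratic {
    quadraticZ : forall a x, q (a *: x) = a ^+ 2 * q x;
    polarDl : forall x y z, polar q (x + y) z = polar q x z + polar q y z;
    polarZl : forall a x y, polar q (a *: x) y = a * polar q x y }.

Definition nondegenerate_quadratic (S : comNzRingType) (M : lmodType S) (q : M -> S) :=
  forall x, (forall y, polar q x y = 0) -> x = 0.

Definition is_basis (S : comNzRingType) (M : lmodType S) n (b : 'I_n -> M) :=
  forall x, exists! c : 'rV[S]_n, x = \sum_i c 0 i *: b i.

(* The coefficients of q in the basis b (upper triangular) ... *)
Definition qcoef (S : comNzRingType) (M : lmodType S) n (b : 'I_n -> M)
    (q : M -> S) : 'M[S]_n :=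
  \matrix_(i, j) if i == j then q (b i)
                 else if (i < j)%N then polar q (b i) (b j) else 0.

(* ... and the quadratic form with given coefficients. *)
Definition qeval (S : comNzRingType) n (C : 'M[S]_n) (x : 'rV[S]_n) : S :=
  \sum_i \sum_j C i j * x 0 i * x 0 j.

(* Base change along r, in the basis b: this gives the form q_L tensor F on
   V = L tensor F, and the reduction of q_L on L / pi L. *)
Definition qbase (S T : comNzRingType) (r : S -> T) (M : lmodType S) n
    (b : 'I_n -> M) (q : M -> S) : 'rV[T]_n -> T :=
  qeval (map_mx r (qcoef b q)).

Lemma polarC (S : nmodType) (T : zmodType) (q : S -> T) x y :
  polar q x y = polar q y x.
Proof. by rewrite /polar [x + y]addrC addrAC. Qed.

Lemma q0 (S : comNzRingType) (M : lmodType S) (q : M -> S) :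
  is_quadratic q -> q 0 = 0.
Proof. by move=> hq; have := quadraticZ hq 0 0; rewrite scale0r expr0n mul0r. Qed.

Lemma polar_sum (S : comNzRingType) (M : lmodType S) (q : M -> S)
    (I : Type) (s : seq I) (f : I -> M) x : is_quadratic q ->
  polar q (\sum_(i <- s) f i) x = \sum_(i <- s) polar q (f i) x.
Proof.
move=> hq; elim: s => [|i s IHs]; last by rewrite !big_cons (polarDl hq) IHs.
by rewrite !big_nil /polar add0r (q0 hq) subr0 subrr.
Qed.

Lemma quadratic_sum (S : comNzRingType) (M : lmodType S) (q : M -> S) n
    (f : 'I_n -> M) : is_quadratic q ->
  q (\sum_i f i) = \sum_i q (f i)
    + \sum_(j < n) \sum_(i < n | (i < j)%N) polar q (f i) (f j).
Proof.
move=> hq; elim: n f => [|n IHn] f; first by rewrite !big_ord0 (q0 hq) addr0.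
rewrite !big_ord_recr /=.
have -> : q (\sum_(i < n) f (widen_ord (leqnSn n) i) + f ord_max) =
    polar q (\sum_(i < n) f (widen_ord (leqnSn n) i)) (f ord_max)
    + q (\sum_(i < n) f (widen_ord (leqnSn n) i)) + q (f ord_max).
  by rewrite /polar addrAC !subrK.
rewrite IHn (polar_sum _ _ _ hq).
under [X in _ = _ + (X + _)]eq_bigr => j _.
  rewrite big_mkcond big_ord_recr /= ltnNge (ltnW (ltn_ord j)) /= addr0.
  rewrite -big_mkcond; over.
rewrite [X in _ = _ + (_ + X)]big_mkcond big_ord_recr /= ltnn addr0.
under [X in _ = _ + (_ + X)]eq_bigr => i _ do rewrite ltn_ord.
by rewrite -addrA addrCA [RHS]addrACA [X in _ + X]addrC.
Qed.

(* qbase is the form induced by q. *)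
Lemma qbaseP (S T : comNzRingType) (r : {rmorphism S -> T}) (M : lmodType S) n
    (b : 'I_n -> M) (q : M -> S) (c : 'rV[S]_n) : is_quadratic q ->
  qbase r b q (map_mx r c) = r (q (\sum_i c 0 i *: b i)).
Proof.
move=> hq.
have -> : qbase r b q (map_mx r c) = r (qeval (qcoef b q) c).
  rewrite /qbase /qeval rmorph_sum; apply: eq_bigr => i _.
  by rewrite rmorph_sum; apply: eq_bigr => j _; rewrite !mxE !rmorphM.
congr (r _); rewrite quadratic_sum // /qeval.
rewrite [X in _ = _ + X](exchange_big_dep xpredT) //=.
rewrite -big_split; apply: eq_bigr => i _ /=.
rewrite (bigD1 i) //= mxE eqxx (quadraticZ hq).
congr (_ + _); first by rewrite expr2 -mulrA mulrC.
rewrite big_mkcond [RHS]big_mkcond; apply: eq_bigr => j _ /=.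
rewrite mxE [i == j]eq_sym; case: eqVneq => [->|_] /=; first by rewrite ltnn.
case: ifP => _; last by rewrite !mul0r.
rewrite (polarZl hq) [X in _ = _ * X]polarC (polarZl hq) [polar q (b j) _]polarC.
by rewrite -mulrA mulrC -mulrA.
Qed.

(* The hyperbolic lattice S^(2k): x_i is the i-th coordinate of the first half
   of x, y_i the i-th coordinate of the second half. *)
Definition hyp (S : comNzRingType) k (x : 'rV[S]_(k + k)) : S :=
  \sum_(i < k) x 0 (lshift k i) * x 0 (rshift k i).

Definition linear_mx (S : comNzRingType) (M : lmodType S) n p (b : 'I_n -> M)
    (phi : M -> 'rV[S]_p) : 'M[S]_(n, p) := \matrix_i phi (b i).

(* The isometric embeddings over kappa of the reduction of (L, q) into the
   reduction of H_k, as matrices acting on row vectors. *)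
Definition prim_isometries_mod (S : comNzRingType) (kappa : finFieldType)
    (red : S -> kappa) (M : lmodType S) n (b : 'I_n -> M) (q : M -> S) (k : nat) :
    {set 'M[kappa]_(n, k + k)} :=
  [set A : 'M[kappa]_(n, k + k) |
    injectiveb (fun x : 'rV[kappa]_n => x *m A) &&
    [forall x : 'rV[kappa]_n, hyp (x *m A) == qbase red b q x]].

(** * Measures on p-adic affine spaces *)

Section PadicMeasure.
Variable K : padicField.

HB.instance Definition _ := isPointed.Build (pf_F K) 0.

(* c + pi^m M_{a x b}(o) *)
Definition pball a b (c : 'M[K]_(a, b)) (m : int) : set 'M[K]_(a, b) :=
  [set x | forall i j, vge pf_v m (x i j - c i j)].

Definition popen a b (D : set 'M[K]_(a, b)) : Prop :=
  forall x, D x -> exists m, pball x m `<=` D.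

Definition pcontinuous a b a' b' (D : set 'M[K]_(a, b))
    (s : 'M[K]_(a, b) -> 'M[K]_(a', b')) : Prop :=
  forall x, D x -> forall m, exists j, forall y, D y -> pball x j y ->
    pball (s x) m (s y).

Definition pballs a b : set (set 'M[K]_(a, b)) :=
  [set B | exists c m, B = pball c m].
Arguments pballs : clear implicits.

(* The Borel sigma-algebra: every open set is a countable union of balls. *)
Local Notation borel a b := (g_sigma_algebraType (pballs a b)).

(* The Haar measure of K^d that gives volume 1 to o^d. *)
Definition is_haar (R : realType) d
    (mu : {measure set (borel 1 d) -> \bar R}) : Prop :=
  (forall (a : 'rV[K]_d) (A : set (borel 1 d)), measurable A ->
     mu ((fun x : 'rV[K]_d => a + x) @` A) = mu A) /\
  mu (pball 0 0) = 1%E.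

(* The absolute value normalized by |pi| = 1/f. *)
Definition pabs (R : realType) (f : nat) (x : K) : R :=
  if x == 0 then 0 else f%:R ^ (- pf_v x).

End PadicMeasure.

Arguments pballs : clear implicits.

Notation borel K a b := (g_sigma_algebraType (pballs K a b)).

(** * The local density form *)

Section LocalDensity.
Variables (K : padicField) (n k : nat).

(* Hom_F(V, W_k) in the bases given by a basis of L and that of H_k. *)
Local Notation Hom := 'M[K]_(n, k + k).

Definition quad_index := {ij : 'I_n * 'I_n | (ij.1 <= ij.2)%N}.

(* The dimensions of Hom_F(V, W_k), of the space of quadratic forms on V, and
   of the fibers of rho. *)
Definition dimHom := (n * (k + k))%N.
Definition dimQuad := #|{: quad_index}|.
Definition dimFib := (dimHom - dimQuad)%N.

(* Determinants in the coordinates for which Hom_o(L, H_k), resp. the integral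
   quadratic forms on L, are the points with coordinates in o, hence have
   volume 1. As alternating forms they are evaluated at sequences of vectors,
   of lengths dimHom and dimQuad. *)
Definition omegaHom (u : seq Hom) : K :=
  \det (\matrix_(i < dimHom) mxvec (nth 0 u i)).

Definition omegaQuad (Q : seq ('rV[K]_n -> K)) : K :=
  \det (\matrix_(i < dimQuad, j < dimQuad)
    qcoef (fun l => delta_mx 0 l) (nth (fun=> 0) Q i)
      (val (enum_val j)).1 (val (enum_val j)).2).

Definition rho (m : Hom) : 'rV[K]_n -> K := fun x => hyp (x *m m).

(* The differential of rho at m, i.e. the coefficient of t in rho (m + t h). *)
Definition drho (m h : Hom) : 'rV[K]_n -> K :=
  fun x => polar (@hyp K k) (x *m m) (x *m h).

Definition fiber (Q : 'rV[K]_n -> K) : set Hom :=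
  [set m | injective (fun x : 'rV[K]_n => x *m m) /\ rho m =1 Q].

(* The form on the fiber defined by
   (rho^* omegaQuad) tensor omega_ld = omegaHom,
   at m and at a family v of dimFib vectors tangent to the fiber. *)
Definition omega_ld (m : Hom) (v : seq Hom) : K :=
  xget 0 [set c : K | forall u : dimQuad.-tuple Hom,
    omegaHom (u ++ v) = omegaQuad (map (drho m) u) * c].

Definition coords (e : 'I_dimFib -> 'I_dimHom) (m : Hom) : 'rV[K]_dimFib :=
  \row_j mxvec m 0 (e j).

(* t is the frame d/dx_(e 0), d/dx_(e 1), ... of the tangent space at m of the
   fiber through m, for the local coordinates (coords e). *)
Definition coord_frame (e : 'I_dimFib -> 'I_dimHom) (m : Hom)
    (t : dimFib.-tuple Hom) : Prop :=
  forall i, drho m (tnth t i) =1 (fun=> 0) /\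
            coords e (tnth t i) = delta_mx 0 i.

(* mu restricts to the measure |omega_ld| on the fiber over Q: on the image of
   every chart s, the inverse of a local coordinate system dx = (coords e), it
   is |g| |dx| where omega_ld = g dx, i.e. g = omega_ld (d/dx_i)_i. Such charts
   cover the fiber, which is smooth, so this determines mu there. *)
Definition is_ld_measure (R : realType) (f : nat)
    (haar : {measure set (borel K 1 dimFib) -> \bar R})
    (Q : 'rV[K]_n -> K)
    (mu : {measure set (borel K n (k + k)) -> \bar R}) : Prop :=
  forall (e : 'I_dimFib -> 'I_dimHom) (D : set 'rV[K]_dimFib)
      (s : 'rV[K]_dimFib -> Hom) (t : 'rV[K]_dimFib -> dimFib.-tuple Hom),
    popen D -> pcontinuous D s ->
    (forall y, D y ->
      [/\ fiber Q (s y), coords e (s y) = y & coord_frame e (s y) (t y)]) ->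
    mu (s @` D) =
      (\int[haar]_(y in D) (pabs R f (omega_ld (s y) (t y)))%:E)%E.

End LocalDensity.

(* The domain of integration: the o-linear phi : L -> H_k that are isometric
   and injective modulo pi, inside Hom_F(V, W_k). *)
Definition prim_isometries (K : padicField) (kappa : fieldType)
    (red : integerRing K -> kappa) (L : lmodType (integerRing K)) n
    (b : 'I_n -> L) (q : L -> integerRing K) (k : nat) :
    set 'M[K]_(n, k + k) :=
  [set m | exists phi : {linear L -> 'rV[integerRing K]_(k + k)},
    [/\ forall x, hyp (phi x) = q x,
        injective (fun x : 'rV[kappa]_n => x *m map_mx red (linear_mx b phi)) &
        m = map_mx (@ival K) (linear_mx b phi)]].

Arguments prim_isometries {K kappa} red {L n} b q k.
Arguments prim_isometries_mod {S kappa} red {M n} b q k.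

(* Main.v *)
Require Import Defs.
From HB Require Import structures.
From mathcomp Require Import all_boot all_order all_algebra all_field.
From mathcomp Require Import all_classical all_reals all_analysis.
From mathcomp Require Import ring zify.

Set Implicit Arguments.
Unset Strict Implicit.
Unset Printing Implicit Defensive.

Import Order.TTheory GRing.Theory Num.Theory.
Local Open Scope classical_set_scope.
Local Open Scope ring_scope.

(** The primitive isometries are partitioned by their reductions A modulo pi.
    Since A is injective and the hyperbolic form is nondegenerate over kappa,
    the differential of rho at A is surjective, so some dim(fiber) coordinates
    complete it to an invertible matrix over kappa. By Hensel's lemma these
    coordinates are then a chart of the whole piece over A, with image a ball of
    radius |pi|. In this chart omega_ld is the inverse of a determinant which is
    a unit, so each piece has the volume f^(-dim(fiber)) of the ball. *)

(** [is_ld_measure] determines [mu] only on images of charts, so a local inverse function theorem is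
    not enough: one chart must fill a whole residue class, and Hensel's lemma is stated for such
    classes. The residue characteristic may be 2, so nothing is divided by 2: a form is recorded by
    its values and polar values on a basis rather than by a Gram matrix, and the differential is
    shown surjective with upper triangular coefficient matrices. [padicField] asserts completeness
    of Q_p only; completeness of the integers of F, on which Hensel's lemma rests, is deduced from
    it by means of the finiteness of the residue field. The coordinates of a chart are chosen over
    [kappa], where a nonzero determinant is all that linear algebra can give; this is enough, since
    an integer with nonzero residue is a unit. *)

HB.instance Definition _ (K : padicField) :=
  GRing.RMorphism.copy (@ival K) (\val : integerRing K -> K).

(** * Valuations on an arbitrary field, applied below to both F and Q_p *)

Section Valuation.
Variables (K : fieldType) (v : K -> int).
Hypothesis hv : is_valuation v.

Lemma val1 : v 1 = 0.
Proof.
have := valuationM hv (oner_neq0 K) (oner_neq0 K).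
by rewrite mulr1 => /esym/eqP; rewrite -subr_eq0 addrK => /eqP.
Qed.

Lemma valN (x : K) : v (- x) = v x.
Proof.
have [->|x0] := eqVneq x 0; first by rewrite oppr0.
have N10 : (- 1 : K) != 0 by rewrite oppr_eq0 oner_neq0.
have vN1 : v (- 1 : K) = 0.
  have := valuationM hv N10 N10.
  rewrite mulrNN mulr1 val1 -mulr2n => /esym/eqP.
  by rewrite mulrn_eq0 => /eqP.
by rewrite -mulN1r (valuationM hv) // vN1 add0r.
Qed.

Lemma valX (x : K) m : x != 0 -> v (x ^+ m) = m%:Z * v x.
Proof.
move=> x0; elim: m => [|m IHm]; first by rewrite expr0 val1 mul0r.
by rewrite exprS (valuationM hv) ?expf_neq0 // IHm intS mulrDl mul1r.
Qed.

Lemma valV (x : K) : x != 0 -> v x^-1 = - v x.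
Proof.
move=> x0; apply/eqP; rewrite -subr_eq0 opprK addrC -(valuationM hv) ?invr_eq0 //.
by rewrite divff // val1.
Qed.

Lemma vge0 m : vge v m 0. Proof. by rewrite /vge eqxx. Qed.

Lemma vgeN m x : vge v m (- x) = vge v m x.
Proof. by rewrite /vge oppr_eq0 valN. Qed.

Lemma vgeD m x y : vge v m x -> vge v m y -> vge v m (x + y).
Proof.
rewrite /vge; have [->|x0] := eqVneq x 0; first by rewrite add0r.
have [->|y0] := eqVneq y 0; first by rewrite addr0 (negbTE x0).
have [//|xy0] := eqVneq (x + y) 0; move=> /= vx vy.
by apply: le_trans (valuationD hv x0 y0 xy0); rewrite le_min vx vy.
Qed.

Lemma vgeM m1 m2 x y : vge v m1 x -> vge v m2 y -> vge v (m1 + m2) (x * y).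
Proof.
rewrite /vge; have [->|x0] := eqVneq x 0; first by rewrite mul0r eqxx.
have [->|y0] := eqVneq y 0; first by rewrite mulr0 eqxx.
by move=> /= vx vy; rewrite (valuationM hv) // lerD ?orbT.
Qed.

Lemma vge_le m1 m2 x : m1 <= m2 -> vge v m2 x -> vge v m1 x.
Proof.
by move=> le12; rewrite /vge; case: eqP => //= _; apply: le_trans.
Qed.

Lemma vge_sum m (I : Type) (s : seq I) (P : pred I) (F : I -> K) :
  (forall i, P i -> vge v m (F i)) -> vge v m (\sum_(i <- s | P i) F i).
Proof.
by move=> h; elim/big_ind: _ => //; [exact: vge0 | exact: vgeD].
Qed.

End Valuation.

(** * Residues and completeness of the ring of integers *)

Section Residues.
Variables (K : padicField) (pi : integerRing K) (kappa : finFieldType)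
  (red : {rmorphism integerRing K -> kappa}).
Hypothesis hred : is_residue_field pi red.
Local Notation O := (integerRing K).
Local Notation v := (@pf_v K).
Let hv : is_valuation v := pf_valuation K.

Lemma ival_inj : injective (@ival K). Proof. exact: val_inj. Qed.

Lemma vge_ival (x : O) : vge v 0 (ival x). Proof. exact: (valP x). Qed.

Lemma vge0_ival (y : K) : vge v 0 y -> exists x : O, ival x = y.
Proof. by move=> hy; exists (IntegerRing hy). Qed.

Lemma vge_divp (m : nat) (x : O) :
  vge v m%:Z (ival x) <-> exists z, x = pi ^+ m * z.
Proof.
have p0 := uniformizer_neq0 hred; have p1 := uniformizer_val hred.
split=> [hx|[z ->]]; last first.
  rewrite rmorphM rmorphXn /= -[m%:Z]addr0; apply: vgeM => //; last exact: vge_ival.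
  by rewrite /vge valX // p1 mulr1 lexx orbT.
have [z hz] : exists z : O, ival z = ival x / ival pi ^+ m.
  apply: vge0_ival; rewrite -(subrr m%:Z); apply: vgeM => //.
  by rewrite /vge valV ?valX ?expf_neq0 // p1 mulr1 lexx orbT.
exists z; apply: ival_inj; rewrite rmorphM rmorphXn /= hz.
by rewrite mulrC divfK // expf_neq0.
Qed.

Lemma red_eq0 (x : O) : red x = 0 <-> exists z, x = pi * z.
Proof. exact: residue_ker hred x. Qed.

Lemma red_unit (x : O) : red x != 0 -> v (ival x) = 0 /\ exists y : O, x * y = 1.
Proof.
move=> rx.
have x0 : x != 0 by apply: contraNneq rx => ->; rewrite rmorph0.
have ix0 : ival x != 0 by rewrite -(rmorph0 (@ival K)) (inj_eq ival_inj).
have vx : v (ival x) = 0.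
  apply/eqP; rewrite eq_le; apply/andP; split; last first.
    by have := vge_ival x; rewrite /vge (negbTE ix0).
  rewrite leNgt; apply: contra rx => vx.
  have /vge_divp[z xz] : vge v 1%:Z (ival x) by rewrite /vge -gtz0_ge1 vx orbT.
  by apply/eqP/red_eq0; exists z; rewrite xz expr1.
split=> //; have [y hy] : exists y : O, ival y = (ival x)^-1.
  by apply: vge0_ival; rewrite /vge valV // vx oppr0 lexx orbT.
by exists y; apply: ival_inj; rewrite rmorphM /= hy divff // rmorph1.
Qed.

Lemma residue_section : exists lift : kappa -> O, cancel lift red.
Proof. by have /choice[lift hlift] := residue_surj hred; exists lift. Qed.

(** Expansion in powers of [pi] with digits lifted from [kappa], evaluated by Horner's rule. Since
    [kappa] is finite, this makes the integers modulo [pi ^+ m] finite. *)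
Lemma residue_system (m : nat) : exists w : m.-tuple kappa -> O,
  forall x, exists t, exists z, x = w t + pi ^+ m * z.
Proof.
have [lift liftK] := residue_section.
exists (foldr (fun a x => lift a + pi * x) 0) => x.
elim: m x => [|m IHm] x; first by exists [tuple], x; rewrite /= add0r expr0 mul1r.
have [x' hx'] : exists x', x - lift (red x) = pi * x'.
  by apply/red_eq0; rewrite rmorphB /= liftK subrr.
have [t [z hz]] := IHm x'; exists [tuple of red x :: t], z => /=.
by rewrite -addrA exprS -mulrA -mulrDr -hz -hx' addrC subrK.
Qed.

(* The digits of the partial sums are taken in a finite set of representatives
   modulo p and the remainders are carried over, so that the convergence follows
   from that of sums of powers of p in Q_p. *)
Lemma p_series_converges (d : nat -> O) : exists l : O, forall N, exists z,
  l - \sum_(j < N) (pf_p K)%:R ^+ j * d j = (pf_p K)%:R ^+ N * z.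
Proof.
have [e e0 he] := pf_extends K.
have hvp := Qp_valuation (pf_is_Qp K).
have prp := pf_prime K.
have [pQ0 vpQ] := Qp_extends (pf_is_Qp K) (prime_gt0 prp).
rewrite logn_prime // eqxx in vpQ.
set p := pf_p K in prp pQ0 vpQ *.
have pA : (p%:R : pf_Qp K)%:A = p%:R :> K by rewrite scaler_nat.
have vpK : v p%:R = e by rewrite -pA he // vpQ mulr1.
have pK0 : (p%:R : K) != 0 by rewrite -pA scaler_eq0 negb_or pQ0 oner_neq0.
have vge_p N (x : O) : vge v (e * N)%N (ival x) -> exists z, x = p%:R ^+ N * z.
  move=> hx; have [z hz] : exists z : O, ival z = ival x / p%:R ^+ N.
    apply: vge0_ival; rewrite -(subrr (e * N)%N%:Z); apply: vgeM => //.
    by rewrite /vge valV ?valX ?expf_neq0 // vpK -PoszM mulnC lexx orbT.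
  exists z; apply: ival_inj; rewrite rmorphM rmorphXn /= rmorph_nat hz.
  by rewrite mulrC divfK // expf_neq0.
(* As v(p) = e, representatives modulo [pi ^+ e] are representatives modulo p. *)
have [w hw] := residue_system e.
have /choice[sel /choice[tl htl]] (x : O) : exists t, exists z, x = w t + p%:R * z.
  have [t [z xz]] := hw x; exists t.
  have [|z' hz'] := vge_p 1%N (x - w t); last first.
    by exists z'; rewrite expr1 in hz'; rewrite -hz' addrC subrK.
  by rewrite muln1; apply/vge_divp; exists z; rewrite xz addrC addKr.
(* [c N] is the coefficient of p^N after the carry from position N - 1; its digit is [w (sel (c N))]
   and [tl (c N)] is carried on. *)
pose c := fix c N := if N is M.+1 then d N + tl (c M) else d 0%N.
pose sigma N := \sum_(j < N) p%:R ^+ j * w (sel (c j)).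
have sumE N : \sum_(j < N.+1) p%:R ^+ j * d j = sigma N + p%:R ^+ N * c N.
  elim: N => [|N IHN]; first by rewrite big_ord1 /sigma big_ord0 add0r.
  rewrite big_ord_recr IHN /sigma big_ord_recr /= -!addrA; congr (_ + _).
  by rewrite {1}[c N]htl mulrDr -addrA; congr (_ + _); rewrite mulrA -exprSr mulrDr addrC.
(* Sorting the terms of [sigma] by their digit leaves, for each of the finitely many t, a sum of
   powers of p, which lives in Q_p and is Cauchy there. *)
pose a t N : pf_Qp K := \sum_(j < N) p%:R ^+ j * (sel (c j) == t)%:R.
have vnat j (b : bool) : vge (@pf_vp K) j%:Z ((p%:R : pf_Qp K) ^+ j * b%:R).
  case: b; last by rewrite mulr0 vge0.
  by rewrite mulr1 /vge valX // vpQ mulr1 lexx orbT.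
have aC t M N : (M <= N)%N -> vge (@pf_vp K) M (a t N - a t M).
  move=> MN; rewrite /a -!(big_mkord xpredT (fun j => p%:R ^+ j * (sel (c j) == t)%:R)).
  rewrite (big_cat_nat (n := M)) //= [X in vge _ _ X]addrC addKr big_nat.
  apply: vge_sum => // j /andP[Mj _]; apply: vge_le (vnat _ _).
  by rewrite lez_nat.
have /choice[l hl] t : exists l, forall N : nat, vge (@pf_vp K) N%:Z (a t N - l).
  have [|l hl] := Qp_complete (pf_is_Qp K) (u := a t).
    move=> m; exists `|m|%N => i j mi mj.
    have {}aC N : (`|m| <= N)%N -> vge (@pf_vp K) m (a t N - a t `|m|%N).
      by move=> /(aC t); apply: vge_le; exact: lez_abs.
    by rewrite -(subrKA (a t `|m|%N)); apply: vgeD => //; [|rewrite -vgeN // opprB]; apply: aC.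
  exists l => N; have [M hM] := hl N%:Z.
  rewrite -(subrKA (a t (maxn M N))); apply: vgeD => //; last exact/hM/leq_maxl.
  by rewrite -vgeN // opprB; apply/aC/leq_maxr.
pose lK : K := \sum_t ival (w t) * (l t)%:A.
have sigmaE N : ival (sigma N) = \sum_t ival (w t) * (a t N)%:A.
  rewrite rmorph_sum /=; under [RHS]eq_bigr => t _ do rewrite /a scaler_suml mulr_sumr.
  rewrite exchange_big /=; apply: eq_bigr => j _.
  rewrite (bigD1 (sel (c j))) //= big1 => [|t /negbTE tj]; last first.
    by rewrite eq_sym tj mulr0 scale0r mulr0.
  rewrite eqxx mulr1 addr0 rmorphXn /= rmorph_nat mulrC; congr (_ * _).
  by rewrite -pA -[LHS](rmorphXn (in_alg K)).
have lsigma N : vge v (e * N)%N (lK - ival (sigma N)).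
  rewrite sigmaE /lK -sumrB; apply: vge_sum => // t _.
  rewrite -mulrBr -scalerBl -[_%:Z]add0r; apply: vgeM => //; first exact: vge_ival.
  have := hl t N; rewrite -vgeN // opprB /vge scaler_eq0 oner_eq0 orbF.
  by case: eqVneq => //= x0 vx; rewrite he // PoszM ler_pM2l.
have [L hL] : exists L : O, ival L = lK.
  apply: vge0_ival; have := lsigma 0%N; rewrite /sigma big_ord0 rmorph0 subr0.
  by rewrite muln0.
(* The partial sum of N + 1 terms differs from [sigma N.+1] by the pending carry p^(N+1) [tl (c N)],
   which is absorbed into the witness. *)
exists L; case=> [|N]; first by exists L; rewrite big_ord0 subr0 expr0 mul1r.
have [|z hz] := vge_p N.+1 (L - sigma N.+1); first by rewrite rmorphB /= hL.
exists (z - tl (c N)); rewrite mulrBr -hz sumE /sigma big_ord_recr /=.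
rewrite {1}[c N]htl mulrDr mulrA -exprSr.
by rewrite !opprD !addrA.
Qed.

(** Along the subsequence of indices e j, consecutive differences are multiples of [pi ^+ (e * j)],
    hence of p^j, because p and [pi ^+ e] divide each other. The subsequence is therefore a
    p-series, and the full sequence follows from i <= e i. *)
Lemma integer_complete (x : nat -> O) :
  (forall i, exists z, x i.+1 - x i = pi ^+ i * z) ->
  exists l, forall i, exists z, l - x i = pi ^+ i * z.
Proof.
move=> hx.
have hxle i j : (i <= j)%N -> exists z, x j - x i = pi ^+ i * z.
  move=> /subnK <-; elim: (j - i)%N => [|k [z hz]]; first by exists 0; rewrite subrr mulr0.
  have [z' hz'] := hx (k + i)%N; exists (pi ^+ k * z' + z).
  by rewrite addSn -(subrKA (x (k + i)%N)) hz hz' mulrDr mulrA -exprD addnC.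
have [e e0 he] := pf_extends K.
have [pQ0 vpQ] := Qp_extends (pf_is_Qp K) (prime_gt0 (pf_prime K)).
rewrite logn_prime ?(pf_prime K) // eqxx in vpQ.
have pA : ((pf_p K)%:R : pf_Qp K)%:A = (pf_p K)%:R :> K by rewrite scaler_nat.
have vpK : v (pf_p K)%:R = e by rewrite -pA he // vpQ mulr1.
have [u hu] : exists u : O, (pf_p K)%:R * u = pi ^+ e.
  have pK0 : ((pf_p K)%:R : K) != 0 by rewrite -pA scaler_eq0 negb_or pQ0 oner_neq0.
  have [u hu] : exists u : O, ival u = ival pi ^+ e / (pf_p K)%:R.
    apply: vge0_ival; have p0 := uniformizer_neq0 hred.
    rewrite /vge (valuationM hv) ?invr_eq0 ?expf_neq0 // valV // valX //.
    by rewrite (uniformizer_val hred) vpK mulr1 subrr lexx orbT.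
  exists u; apply: ival_inj; rewrite rmorphM rmorphXn /= rmorph_nat hu.
  by rewrite mulrC divfK.
have [w hw] : exists w : O, (pf_p K)%:R = pi ^+ e * w.
  by apply/vge_divp; rewrite rmorph_nat /vge vpK lexx orbT.
have /choice[d hd] j : exists d, x (e * j.+1)%N - x (e * j)%N = (pf_p K)%:R ^+ j * d.
  have [|z hz] := hxle (e * j)%N (e * j.+1)%N; first by rewrite leq_mul.
  by exists (u ^+ j * z); rewrite hz exprM -hu exprMn mulrA.
have xE N : x (e * N)%N = x 0%N + \sum_(j < N) (pf_p K)%:R ^+ j * d j.
  elim: N => [|N IHN]; first by rewrite muln0 big_ord0 addr0.
  by rewrite big_ord_recr /= addrA -IHN -hd addrC subrK.
have [l hl] := p_series_converges d.
exists (x 0%N + l) => i; have [z hz] := hl i.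
have ei : (i <= e * i)%N by rewrite leq_pmull.
have [z' hz'] := hxle _ _ ei.
exists (pi ^+ (e * i - i) * (w ^+ i * z) + z').
rewrite mulrDr -hz' mulrA -exprD subnKC // exprM mulrA -exprMn -hw -hz xE.
by rewrite [x 0%N + \sum_(_ < _) _]addrC -!addrA addKr addrCA.
Qed.

End Residues.

(** * Congruences of matrices modulo powers of an element *)

Section Congruence.
Variables (S : comNzRingType) (p : S).

Definition congr_mod (m : nat) a b (X Y : 'M[S]_(a, b)) : Prop :=
  exists Z, X - Y = p ^+ m *: Z.

Lemma congr_refl m a b (X : 'M[S]_(a, b)) : congr_mod m X X.
Proof. by exists 0; rewrite subrr scaler0. Qed.

Lemma congr_sym m a b (X Y : 'M[S]_(a, b)) : congr_mod m X Y -> congr_mod m Y X.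
Proof. by case=> Z hZ; exists (- Z); rewrite scalerN -hZ opprB. Qed.

Lemma congr_trans m a b (Y X Z : 'M[S]_(a, b)) :
  congr_mod m X Y -> congr_mod m Y Z -> congr_mod m X Z.
Proof. by case=> U hU [V hV]; exists (U + V); rewrite scalerDr -hU -hV subrKA. Qed.

Lemma congr_add m a b (X Y X' Y' : 'M[S]_(a, b)) :
  congr_mod m X Y -> congr_mod m X' Y' -> congr_mod m (X + X') (Y + Y').
Proof. by case=> U hU [V hV]; exists (U + V); rewrite scalerDr -hU -hV addrACA opprD. Qed.

Lemma congr_mulr m a b c (X Y : 'M[S]_(a, b)) (A : 'M[S]_(b, c)) :
  congr_mod m X Y -> congr_mod m (X *m A) (Y *m A).
Proof. by case=> U hU; exists (U *m A); rewrite scalemxAl -hU mulmxBl. Qed.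

Lemma congr_le m m' a b (X Y : 'M[S]_(a, b)) :
  (m <= m')%N -> congr_mod m' X Y -> congr_mod m X Y.
Proof.
by move=> mm' [U hU]; exists (p ^+ (m' - m) *: U); rewrite scalerA -exprD subnKC.
Qed.

Lemma congr0 a b (X Y : 'M[S]_(a, b)) : congr_mod 0 X Y.
Proof. by exists (X - Y); rewrite expr0 scale1r. Qed.

Lemma congrP m a b (X Y : 'M[S]_(a, b)) :
  congr_mod m X Y <-> forall i j, exists z, X i j - Y i j = p ^+ m * z.
Proof.
split=> [[Z hZ] i j|h].
  by exists (Z i j); move/matrixP/(_ i j): hZ; rewrite !mxE.
have /choice[f hf] i : exists f, forall j, X i j - Y i j = p ^+ m * f j.
  by have /choice[f hf] := h i; exists f.
by exists (\matrix_(i, j) f i j); apply/matrixP => i j; rewrite !mxE hf.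
Qed.

End Congruence.

(** * Hensel's lemma on a residue class *)

Section Hensel.
Variables (K : padicField) (pi : integerRing K) (kappa : finFieldType)
  (red : {rmorphism integerRing K -> kappa}).
Hypothesis hred : is_residue_field pi red.
Local Notation O := (integerRing K).
Local Notation v := (@pf_v K).

Lemma congr_red a b (X Y : 'M[O]_(a, b)) :
  congr_mod pi 1 X Y <-> map_mx red X = map_mx red Y.
Proof.
rewrite congrP; split=> [h|h i j].
  apply/matrixP => i j; rewrite !mxE; apply/eqP; rewrite -subr_eq0 -rmorphB.
  by apply/eqP/(red_eq0 hred); have [z hz] := h i j; exists z; rewrite hz expr1.
rewrite expr1; apply/(red_eq0 hred); rewrite rmorphB.
by move/matrixP/(_ i j): h; rewrite !mxE => ->; rewrite subrr.
Qed.

Lemma congr_pball (m : nat) a b (X Y : 'M[O]_(a, b)) :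
  congr_mod pi m X Y <-> pball (map_mx (@ival K) Y) m%:Z (map_mx (@ival K) X).
Proof.
rewrite congrP; split=> h i j.
  by rewrite !mxE -rmorphB; apply/(vge_divp hred)/h.
by apply/(vge_divp hred); have := h i j; rewrite !mxE -rmorphB.
Qed.

Lemma congr_separated a b (X Y : 'M[O]_(a, b)) :
  (forall m, congr_mod pi m X Y) -> X = Y.
Proof.
move=> h; apply/matrixP => i j; apply/eqP; rewrite -subr_eq0; apply/negPn/negP => z0.
have iz0 : ival (X i j - Y i j) != 0.
  by rewrite -(rmorph0 (@ival K)) (inj_eq (@ival_inj K)).
pose w := v (ival (X i j - Y i j)).
have : vge v `|w|.+1%:Z (ival (X i j - Y i j)).
  by apply/(vge_divp hred); have /congrP := h `|w|.+1; apply.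
by rewrite /vge (negbTE iz0) /= leNgt (le_lt_trans (lez_abs w)) // ltz_nat.
Qed.

Lemma matrix_complete a b (x : nat -> 'M[O]_(a, b)) :
  (forall i, congr_mod pi i (x i.+1) (x i)) ->
  exists l, forall i, congr_mod pi i l (x i).
Proof.
move=> hx.
have hl s t : exists l, forall i, exists z, l - x i s t = pi ^+ i * z.
  by apply: (integer_complete hred) => i; have /congrP := hx i; apply.
have /choice[l {}hl] s : exists l, forall t i, exists z, l t - x i s t = pi ^+ i * z.
  by have /choice[l {}hl] := hl s; exists l.
exists (\matrix_(s, t) l s t) => i; apply/congrP => s t; rewrite mxE; exact: hl.
Qed.

(** Banach's fixed point theorem on the residue class of [x0], with contraction factor |pi|. The
    contraction at m = 0, where the congruence hypothesis is void, keeps the iterates in the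
    class. *)
Lemma contraction_fixpoint a b (g : 'M[O]_(a, b) -> 'M[O]_(a, b)) x0 :
  congr_mod pi 1 (g x0) x0 ->
  (forall m x y, congr_mod pi 1 x x0 -> congr_mod pi 1 y x0 ->
    congr_mod pi m x y -> congr_mod pi m.+1 (g x) (g y)) ->
  exists2 x, congr_mod pi 1 x x0 & g x = x.
Proof.
move=> g0 hg; pose x i := iter i g x0.
have hx i : congr_mod pi 1 (x i) x0.
  elim: i => [|i IHi]; first exact: congr_refl.
  by apply: congr_trans g0; apply: hg => //; [exact: congr_refl|exact: congr0].
have xC i : congr_mod pi i.+1 (x i.+1) (x i).
  by elim: i => [|i IHi]; [exact: g0|exact: hg (hx i.+1) (hx i) IHi].
have [|l hl] := @matrix_complete _ _ x.
  by move=> i; apply: congr_le (leqnSn i) (xC i).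
have l0 : congr_mod pi 1 l x0 by apply: congr_trans (hx 1%N).
exists l => //; apply: congr_separated => m.
apply: (congr_trans (Y := x m.+1)); last exact/congr_le/congr_sym/hl.
by apply: (congr_le (leqnSn m)); apply: hg.
Qed.

Section InverseFunction.
Variables (N a : nat) (F : 'rV[O]_N -> 'rV[O]_a) (J : 'M[O]_(N, a)) (J' : 'M[O]_(a, N)).
Variable x0 : 'rV[O]_N.
Hypotheses (JJ' : J *m J' = 1%:M) (J'J : J' *m J = 1%:M).
(** Strict differentiability with one derivative [J] for the whole residue class: the error is
    smaller than the increment by a factor |pi|. *)
Hypothesis hF : forall m x y, congr_mod pi 1 x x0 -> congr_mod pi 1 y x0 ->
  congr_mod pi m x y -> congr_mod pi m.+1 (F x - F y) ((x - y) *m J).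

(** Newton's iteration with the derivative frozen; its fixed points solve F x = t, and [hF] makes it
    a contraction. *)
Let newton t x := x - (F x - t) *m J'.

Let newton_contraction t m x y : congr_mod pi 1 x x0 -> congr_mod pi 1 y x0 ->
  congr_mod pi m x y -> congr_mod pi m.+1 (newton t x) (newton t y).
Proof.
move=> hx hy /(hF hx hy)/(congr_mulr J')/congr_sym[Z hZ]; exists Z; rewrite -hZ.
rewrite /newton -mulmxA JJ' mulmx1 !mulmxBl (opprD y) addrACA -opprD.
by congr (_ - _); rewrite opprB addrA subrK.
Qed.

Lemma hensel_surjective t : congr_mod pi 1 (F x0) t ->
  exists2 x, congr_mod pi 1 x x0 & F x = t.
Proof.
move=> [Z hZ].
have [|x hx /eqP hfix] := contraction_fixpoint _ (@newton_contraction t).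
  by exists (- (Z *m J')); rewrite /newton addrAC subrr add0r hZ scalerN -scalemxAl.
exists x => //; apply/eqP; rewrite -subr_eq0 -[_ - t]mulmx1 -J'J mulmxA.
suff -> : (F x - t) *m J' = 0 by rewrite mul0mx.
by apply/eqP; move: hfix; rewrite /newton -subr_eq0 addrAC subrr add0r oppr_eq0.
Qed.

(** Each z is [newton 0 z] plus the image of [F z]. The first part gains one power of [pi] at each
    step of the induction, while the second is already congruent modulo [pi ^+ m]. *)
Lemma hensel_injective m x y : congr_mod pi 1 x x0 -> congr_mod pi 1 y x0 ->
  congr_mod pi m (F x) (F y) -> congr_mod pi m x y.
Proof.
move=> hx hy hxy.
suff h i : (i <= m)%N -> congr_mod pi i x y by apply: h.
elim: i => [|i IHi] im; first exact: congr0.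
have E z : z = newton 0 z + F z *m J' by rewrite /newton subr0 subrK.
rewrite (E x) (E y); apply: congr_add.
  by apply: newton_contraction => //; apply: IHi; exact: ltnW.
exact/congr_mulr/(congr_le im).
Qed.

End InverseFunction.

(** The determinant has nonzero residue, hence is a unit, and the adjugate gives an integral
    inverse. [J] has a columns with a = N only propositionally, whence the cast. *)
Lemma integral_inverse N a (h : a = N) (J : 'M[O]_(N, a)) :
  \det (castmx (erefl, h) (map_mx red J)) != 0 ->
  exists J', J *m J' = 1%:M /\ J' *m J = 1%:M.
Proof.
case: N / h J => J; rewrite castmx_id det_map_mx => /(red_unit hred)[_ [d hd]].
exists (d *: \adj J); rewrite -scalemxAr -scalemxAl mul_mx_adj mul_adj_mx.
by rewrite scale_scalar_mx mulrC hd.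
Qed.

End Hensel.

(** * Quadratic forms in coordinates, and the expansion of [rho] *)

Section QuadraticForms.
Variable S : comNzRingType.

(** The Gram matrix of the hyperbolic form exchanges the two halves of a vector. *)
Lemma polar_hyp k (x y : 'rV[S]_(k + k)) :
  polar (@hyp S k) x y = (x *m (row_mx (rsubmx y) (lsubmx y))^T) 0 0.
Proof.
rewrite mxE big_split_ord /= /polar /hyp -!sumrB -big_split; apply: eq_bigr => i _ /=.
by rewrite ![_^T _ _]mxE row_mxEl row_mxEr !mxE; ring.
Qed.

Lemma bilinear_quadratic (M : lmodType S) (B : M -> M -> S) :
  (forall x y z, B (x + y) z = B x z + B y z) ->
  (forall x y z, B x (y + z) = B x y + B x z) ->
  (forall a x y, B (a *: x) y = a * B x y) ->
  (forall a x y, B x (a *: y) = a * B x y) ->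
  is_quadratic (fun x => B x x).
Proof.
move=> BDl BDr BZl BZr.
have polarE x y : polar (fun x => B x x) x y = B x y + B y x.
  by rewrite /polar BDl !BDr; ring.
split=> [a x|x y z|a x y]; first by rewrite BZl BZr mulrA expr2.
  by rewrite !polarE BDl BDr addrACA.
by rewrite !polarE BZl BZr mulrDr.
Qed.

Lemma polar_hypD k (x y z : 'rV[S]_(k + k)) :
  polar (@hyp S k) (x + y) z = polar (@hyp S k) x z + polar (@hyp S k) y z.
Proof. by rewrite !polar_hyp mulmxDl mxE. Qed.

Lemma polar_hypZ k a (x y : 'rV[S]_(k + k)) :
  polar (@hyp S k) (a *: x) y = a * polar (@hyp S k) x y.
Proof. by rewrite !polar_hyp -scalemxAl mxE. Qed.

Lemma hyp_quadratic k : is_quadratic (@hyp S k).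
Proof.
split; [move=> a x | exact: polar_hypD | exact: polar_hypZ].
by rewrite /hyp mulr_sumr; apply: eq_bigr => i _; rewrite !mxE; ring.
Qed.

Lemma quadratic_comp (M M' : lmodType S) (q : M' -> S) (f : M -> M') :
  (forall x y, f (x + y) = f x + f y) -> (forall a x, f (a *: x) = a *: f x) ->
  is_quadratic q -> is_quadratic (q \o f).
Proof.
move=> fD fZ hq; have polarE x y : polar (q \o f) x y = polar q (f x) (f y).
  by rewrite /polar /= fD.
split=> [a x|x y z|a x y]; first by rewrite /= fZ (quadraticZ hq).
  by rewrite !polarE fD (polarDl hq).
by rewrite !polarE fZ (polarZl hq).
Qed.

Lemma qeval_quadratic n (C : 'M[S]_n) : is_quadratic (qeval C).
Proof.
rewrite /qeval.
apply: (@bilinear_quadratic _ (fun x y : 'rV[S]_n => \sum_i \sum_j C i j * x 0 i * y 0 j)).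
- move=> x y z; rewrite -big_split; apply: eq_bigr => i _.
  by rewrite -big_split; apply: eq_bigr => j _; rewrite !mxE /=; ring.
- move=> x y z; rewrite -big_split; apply: eq_bigr => i _.
  by rewrite -big_split; apply: eq_bigr => j _; rewrite !mxE /=; ring.
- move=> a x y; rewrite mulr_sumr; apply: eq_bigr => i _.
  by rewrite mulr_sumr; apply: eq_bigr => j _; rewrite !mxE; ring.
- move=> a x y; rewrite mulr_sumr; apply: eq_bigr => i _.
  by rewrite mulr_sumr; apply: eq_bigr => j _; rewrite !mxE; ring.
Qed.

Variables n k : nat.

Lemma drho_quadratic (X h : 'M[S]_(n, k + k)) :
  is_quadratic (fun x => polar (@hyp S k) (x *m X) (x *m h)).
Proof.
apply: (@bilinear_quadratic _ (fun x y => polar (@hyp S k) (x *m X) (y *m h))).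
- by move=> x y z; rewrite mulmxDl polar_hypD.
- by move=> x y z; rewrite mulmxDl ![polar _ (x *m X) _]polarC polar_hypD.
- by move=> a x y; rewrite -scalemxAl polar_hypZ.
- by move=> a x y; rewrite -scalemxAl ![polar _ (x *m X) _]polarC polar_hypZ.
Qed.

(** The coordinates in which [omegaQuad] is a determinant, in the same order. *)
Definition qvec (q : 'rV[S]_n -> S) : 'rV[S]_(dimQuad n) :=
  \row_j qcoef (fun l => delta_mx 0 l) q (val (enum_val j)).1 (val (enum_val j)).2.

Lemma eq_qvec (q q' : 'rV[S]_n -> S) : q =1 q' -> qvec q = qvec q'.
Proof. by move=> h; apply/rowP => j; rewrite !mxE /polar !h. Qed.

Lemma qvecD (q q' : 'rV[S]_n -> S) : qvec (fun x => q x + q' x) = qvec q + qvec q'.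
Proof.
apply/rowP => j; rewrite !mxE /polar.
by case: ifP => _ //; case: ifP => _; ring.
Qed.

Lemma qvecZ a (q : 'rV[S]_n -> S) : qvec (fun x => a * q x) = a *: qvec q.
Proof.
apply/rowP => j; rewrite !mxE /polar.
by case: ifP => _ //; case: ifP => _; ring.
Qed.

Lemma qvec_inj (q q' : 'rV[S]_n -> S) : is_quadratic q -> is_quadratic q' ->
  qvec q = qvec q' -> q =1 q'.
Proof.
move=> hq hq' qq'.
have E (r : 'rV[S]_n -> S) : is_quadratic r ->
    r =1 qeval (qcoef (fun l => delta_mx 0 l) r).
  move=> hr x; have := @qbaseP S S idfun _ n (fun l => delta_mx 0 l) r x hr.
  by rewrite /qbase !map_mx_id //= -row_sum_delta.
suff C : qcoef (fun l => delta_mx 0 l) q = qcoef (fun l => delta_mx 0 l) q'.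
  by move=> x; rewrite (E q) // (E q') // C.
apply/matrixP => i j; have [ij|ji] := leqP i j; last first.
  by rewrite !mxE ltnNge (ltnW ji) /=; case: eqVneq ji => // ->; rewrite ltnn.
pose s : quad_index n := exist _ (i, j) ij.
by move/rowP/(_ (enum_rank s)): qq'; rewrite !(mxE, enum_rankK).
Qed.

Definition drho_vec (X : 'M[S]_(n, k + k)) (u : 'rV[S]_(n * (k + k))) : 'rV[S]_(dimQuad n) :=
  qvec (fun x => polar (@hyp S k) (x *m X) (x *m vec_mx u)).

Lemma drho_vec_linear X : linear (drho_vec X).
Proof.
move=> a u w; rewrite /drho_vec -qvecZ -qvecD; apply: eq_qvec => x.
rewrite ![polar _ (x *m X) _]polarC linearP mulmxDr -scalemxAr.
by rewrite polar_hypD polar_hypZ.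
Qed.

HB.instance Definition _ X := GRing.isLinear.Build _ _ _ _ (drho_vec X) (drho_vec_linear X).

Definition drho_mx X : 'M[S]_(n * (k + k), dimQuad n) := lin1_mx (drho_vec X).

Lemma mul_drho_mx X u : u *m drho_mx X = drho_vec X u.
Proof. exact: mul_rV_lin1. Qed.

Lemma drho_mx_linear a X Y : drho_mx (a *: X + Y) = a *: drho_mx X + drho_mx Y.
Proof.
apply/row_matrixP => i; rewrite !rowE mulmxDr -scalemxAr !mul_drho_mx.
rewrite -qvecZ -qvecD; apply: eq_qvec => x.
by rewrite mulmxDr -scalemxAr polar_hypD polar_hypZ.
Qed.

Definition rho_vec (u : 'rV[S]_(n * (k + k))) : 'rV[S]_(dimQuad n) :=
  qvec (fun x => @hyp S k (x *m vec_mx u)).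

(** The Taylor expansion of [rho], exact at order two since [rho] is quadratic in the matrix. *)
Lemma rho_vecD u w : rho_vec (u + w) = rho_vec u + w *m drho_mx (vec_mx u) + rho_vec w.
Proof.
rewrite mul_drho_mx -!qvecD; apply: eq_qvec => x.
by rewrite linearD mulmxDr /polar; ring.
Qed.

Lemma rho_vecZ a u : rho_vec (a *: u) = a ^+ 2 *: rho_vec u.
Proof.
rewrite -qvecZ; apply: eq_qvec => x.
by rewrite linearZ -scalemxAr (quadraticZ (hyp_quadratic k)).
Qed.

End QuadraticForms.

Section BaseChange.
Variables (S T : comNzRingType) (r : {rmorphism S -> T}).

Lemma map_hyp k (x : 'rV[S]_(k + k)) : r (hyp x) = hyp (map_mx r x).
Proof. by rewrite /hyp rmorph_sum; apply: eq_bigr => i _; rewrite rmorphM !mxE. Qed.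

Lemma map_qvec n (q : 'rV[S]_n -> S) (q' : 'rV[T]_n -> T) :
  (forall x, r (q x) = q' (map_mx r x)) -> map_mx r (qvec q) = qvec q'.
Proof.
move=> h; apply/rowP => j; rewrite !mxE /polar.
case: ifP => _; first by rewrite h map_delta_mx.
by case: ifP => _; rewrite ?rmorph0 // !rmorphB /= !h map_mxD !map_delta_mx.
Qed.

Lemma map_rho_vec n k (u : 'rV[S]_(n * (k + k))) :
  map_mx r (rho_vec u) = rho_vec (map_mx r u).
Proof. by apply: map_qvec => x; rewrite map_hyp map_mxM map_vec_mx. Qed.

Lemma map_drho_mx n k (X : 'M[S]_(n, k + k)) :
  map_mx r (drho_mx X) = drho_mx (map_mx r X).
Proof.
apply/row_matrixP => i; rewrite -map_row !rowE !mul_drho_mx; apply: map_qvec => x.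
by rewrite /polar !rmorphB /= !map_hyp map_mxD !map_mxM map_vec_mx map_delta_mx.
Qed.

End BaseChange.

(** * Surjectivity of the differential over a field *)

Section SurjectiveDifferential.
Variables (F : fieldType) (n k : nat).

(** With A B = 1 and G the Gram matrix of the hyperbolic form, a direction h with G h^T = B C has
    image x A B C x^T = x C x^T. Upper triangular elementary matrices C give the coordinate vectors,
    in every characteristic. *)
Lemma drho_mx_full (A : 'M[F]_(n, k + k)) : row_free A -> row_full (drho_mx A).
Proof.
move=> /row_freeP[B AB].
have h (j : 'I_(dimQuad n)) : exists u : 'rV_(n * (k + k)), u *m drho_mx A = delta_mx 0 j.
  pose s := val (enum_val j); pose C : 'M[F]_n := delta_mx s.1 s.2.
  pose H := (B *m C)^T.
  exists (mxvec (row_mx (rsubmx H) (lsubmx H))); rewrite mul_drho_mx /drho_vec mxvecK.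
  transitivity (qvec (fun x : 'rV[F]_n => (x *m C *m x^T) 0 0)).
    apply: eq_qvec => x; rewrite polar_hyp mul_mx_row row_mxKr row_mxKl.
    rewrite -mul_mx_row hsubmxK trmx_mul /H trmxK !mulmxA.
    by rewrite -(mulmxA x A B) AB mulmx1.
  have CE i l : ((delta_mx 0 i : 'rV[F]_n) *m C *m (delta_mx 0 l : 'rV[F]_n)^T) 0 0 = C i l.
    by rewrite -rowE trmx_delta -colE !mxE.
  have CD i l : (((delta_mx 0 i : 'rV[F]_n) + delta_mx 0 l) *m C
      *m ((delta_mx 0 i : 'rV[F]_n) + delta_mx 0 l)^T) 0 0
      = C i i + C i l + (C l i + C l l).
    have addE (U W : 'M[F]_1) : (U + W) 0 0 = U 0 0 + W 0 0 by rewrite mxE.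
    by rewrite linearD /= mulmxDl mulmxDr !mulmxDl !addE !CE; ring.
  apply/rowP => j'. rewrite 2!mxE [RHS]mxE eqxx /polar CD !CE.
  have -> : (j' == j) = (val (enum_val j') == s).
    by rewrite (inj_eq val_inj) (inj_eq enum_val_inj).
  rewrite /C !mxE.
  clear H CE CD; clear C.
  case: (enum_val j') (valP (enum_val j)) => -[a c] /= ac; rewrite -/s.
  case: s => i l /= il; rewrite xpair_eqE /=.
  case: eqVneq ac => [<-|ac'] ac; first by [].
  rewrite ltn_neqAle ac' ac /=.
  (* The polar form also picks up the transposed entry of C; it vanishes, as a < c and i <= l. *)
  rewrite (_ : (c == i) && (a == l) = false); first by rewrite mulr0n; ring.
  apply/negP => /andP[/eqP ci /eqP al]; case/negP: ac'; apply/eqP/val_inj/eqP.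
  by rewrite eqn_leq ac /= ci al.
have [U hU] := choice h.
apply/row_fullP; exists (\matrix_j U j); apply/row_matrixP => j.
by rewrite row_mul rowK hU row1.
Qed.

End SurjectiveDifferential.

(** The upper and lower triangles have equal size, cover the n^2 pairs, and meet in the n diagonal
    ones. *)
Lemma dimQuadE n : dimQuad n = ((n ^ 2 + n)./2)%N.
Proof.
pose A := [set ij : 'I_n * 'I_n | (ij.1 <= ij.2)%N]%SET.
pose B := [set ij : 'I_n * 'I_n | (ij.2 <= ij.1)%N]%SET.
have -> : dimQuad n = #|A| by rewrite /dimQuad card_sig /A cardsE.
have AB : #|B| = #|A|.
  have swapK : involutive (fun ij : 'I_n * 'I_n => (ij.2, ij.1)) by case.
  rewrite -(card_imset _ (inv_inj swapK)); apply: eq_card => ij.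
  apply/imsetP/idP => [[x xB ->]|ijA]; first by move: xB; rewrite !inE.
  by exists (ij.2, ij.1); rewrite ?swapK //; move: ijA; rewrite !inE.
have := cardsUI A B; rewrite AB.
have -> : A :|: B = [set: 'I_n * 'I_n]%SET.
  by apply/setP => ij; rewrite /A /B !inE leq_total.
have -> : A :&: B = [set (i, i) | i : 'I_n]%SET.
  apply/setP => -[i j]; rewrite /A /B !inE /= -eqn_leq; apply/eqP/imsetP => [ij|[l _ [-> ->]] //].
  by exists j => //; congr pair; apply: val_inj.
rewrite cardsT card_prod card_imset ?cardsT ?card_ord => [|i j []//].
by rewrite addnn -mulnn => ->; rewrite doubleK.
Qed.

Lemma dimQuad_leq n k : (n <= k)%N -> (dimQuad n <= dimHom n k)%N.
Proof. by move=> nk; rewrite dimQuadE /dimHom; nia. Qed.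

(** * Linear algebra of complementary coordinates *)

Section Frames.

Lemma rank_rowsub (F : fieldType) m p r (A : 'M[F]_(m, p)) : \rank A = r ->
  exists e : 'I_r -> 'I_m, \rank (rowsub e A) = r.
Proof.
move=> h; case: r / h; exists (maxrankfun A).
by apply/eqP; exact: maxrowsub_free.
Qed.

(** The kernel of [D] has dimension c, so c independent columns of [kermx D] name coordinates that
    are injective on it. A vector killed by [D] and by these coordinates is then zero. *)
Lemma complement_columns (F : fieldType) N a c (h : (a + c)%N = N) (D : 'M[F]_(N, a)) :
  row_full D -> exists e : 'I_c -> 'I_N,
    \det (castmx (erefl, h) (row_mx D (colsub e 1%:M))) != 0.
Proof.
move=> /eqP rD; have rk : \rank (kermx D)^T = c.
  by rewrite mxrank_tr mxrank_ker rD -h addKn.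
have [e he] := rank_rowsub rk; exists e.
case: N / h D rD rk e he => D rD rk e he; rewrite castmx_id.
rewrite -unitfE -unitmxE -row_free_unit; apply: inj_row_free => u.
rewrite mul_mx_row -[0]row_mx0 => /eq_row_mx[/sub_kermxP uD /sub_kermxP uE].
have := mxrank_mul_ker (kermx D) (colsub e 1%:M).
rewrite mulmx_colsub mulmx1 -mxrank_tr trmx_mxsub he => rcap.
have /eqP : \rank (kermx D :&: kermx (colsub e 1%:M))%MS = 0%N.
  by apply: (@addnI c); rewrite rcap addn0 -mxrank_tr.
rewrite mxrank_eq0 => /eqP cap0.
by apply/eqP; rewrite row_mx0 -submx0 -cap0 sub_capmx uD.
Qed.

(** [U] and [V] are the row blocks of the inverse matrix; [V] is the frame of the kernel of [D] dual
    to the coordinates [E]. *)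
Lemma dual_frame (F : fieldType) N a c (h : (a + c)%N = N)
    (D : 'M[F]_(N, a)) (E : 'M[F]_(N, c)) :
  \det (castmx (erefl, h) (row_mx D E)) != 0 ->
  exists U V, [/\ U *m D = 1%:M, V *m D = 0 & V *m E = 1%:M].
Proof.
case: N / h D E => D E; rewrite castmx_id -unitfE -unitmxE => /mulVmx.
rewrite -{1}[invmx _]vsubmxK mul_col_row (@scalar_mx_block F a c) => /eq_block_mx[UD _ VD VE].
by exists (usubmx (invmx (row_mx D E))), (dsubmx (invmx (row_mx D E))).
Qed.

(** The product of the two square matrices is block triangular, with diagonal blocks [U *m D] and
    1. *)
Lemma det_frame (S : comNzRingType) N a c (h : (a + c)%N = N)
    (U : 'M[S]_(a, N)) (V : 'M[S]_(c, N)) (D : 'M[S]_(N, a)) (E : 'M[S]_(N, c)) :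
  V *m D = 0 -> V *m E = 1%:M ->
  \det (castmx (h, erefl) (col_mx U V)) * \det (castmx (erefl, h) (row_mx D E))
    = \det (U *m D).
Proof.
case: N / h U V D E => U V D E VD VE.
by rewrite !castmx_id -det_mulmx mul_col_row VD VE det_ublock det1 mulr1.
Qed.

End Frames.

Section FrameDeterminant.
Variables (n k : nat).
Hypothesis nk : (n <= k)%N.

Definition dimHomE : (dimQuad n + dimFib n k)%N = dimHom n k := subnKC (dimQuad_leq nk).

(** The Jacobian matrix at m of the map with components [rho] and [coords e]. *)
Definition frame_mx (S : comNzRingType) (e : 'I_(dimFib n k) -> 'I_(dimHom n k))
    (m : 'M[S]_(n, k + k)) : 'M[S]_(dimHom n k, dimQuad n + dimFib n k) :=
  row_mx (drho_mx m) (colsub e 1%:M).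

Definition frame_det (S : comNzRingType) e (m : 'M[S]_(n, k + k)) : S :=
  \det (castmx (erefl, dimHomE) (frame_mx e m)).

Lemma map_frame_mx (S T : comNzRingType) (r : {rmorphism S -> T}) e m :
  map_mx r (frame_mx e m) = frame_mx e (map_mx r m).
Proof. by rewrite map_row_mx map_drho_mx map_mxsub map_mx1. Qed.

Lemma map_frame_det (S T : comNzRingType) (r : {rmorphism S -> T}) e m :
  r (frame_det e m) = frame_det e (map_mx r m).
Proof. by rewrite -det_map_mx map_castmx map_frame_mx. Qed.

End FrameDeterminant.

(** * The form [omega_ld] in a chart *)

Section LocalDensityForm.
Variables (K : padicField) (n k : nat).
Hypothesis nk : (n <= k)%N.
Local Notation Hom := 'M[K]_(n, k + k).
Local Notation dimHomE := (dimHomE nk).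
Local Notation frame_det := (frame_det nk).

Lemma coordsE e (m : Hom) : coords e m = mxvec m *m colsub e 1%:M.
Proof. by rewrite mulmx_colsub mulmx1; apply/rowP => j; rewrite !mxE. Qed.

Lemma coord_frame_exists e (m : Hom) : frame_det e m != 0 -> exists t, coord_frame e m t.
Proof.
move=> /dual_frame[U [V [_ VD VE]]].
exists [tuple vec_mx (row i V) | i < dimFib n k] => i; rewrite tnth_mktuple.
split; last by rewrite coordsE vec_mxK -row_mul VE row1.
apply: qvec_inj; first exact: drho_quadratic.
  by split=> [a x|x y z|a x y]; rewrite /polar !(subr0, mulr0, addr0).
rewrite -[LHS]/(drho_vec m (row i V)) -mul_drho_mx -row_mul VD row0.
by apply/rowP => j; rewrite !mxE /polar !subr0 !if_same.
Qed.

(** By [det_frame], applied to arbitrary u and the coordinate frame t, [omegaHom] on u ++ t times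
    the Jacobian determinant is [omegaQuad] of the images of u. This is the equation defining
    [omega_ld]. *)
Lemma omega_ldE e (m : Hom) t : frame_det e m != 0 -> coord_frame e m t ->
  omega_ld m t = (frame_det e m)^-1.
Proof.
move=> d0 ht.
pose V := \matrix_i mxvec (tnth t i).
have VD : V *m drho_mx m = 0.
  apply/row_matrixP => i; rewrite row_mul rowK mul_drho_mx row0 /drho_vec mxvecK.
  rewrite (eq_qvec (q' := fun=> 0)) => [|x]; last exact: (ht i).1 x.
  by apply/rowP => j; rewrite !mxE /polar !subr0 !if_same.
have VE : V *m colsub e 1%:M = 1%:M.
  apply/row_matrixP => i; rewrite row_mul rowK -coordsE row1.
  by have [] := ht i.
have omegaHomE (u : (dimQuad n).-tuple Hom) : omegaHom (u ++ t) =
    \det (castmx (dimHomE, erefl) (col_mx (\matrix_i mxvec (tnth u i)) V)).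
  congr (\det _); apply/row_matrixP => i; rewrite rowK; apply/rowP => j.
  rewrite [RHS]mxE [RHS]castmxE /= cast_ord_id nth_cat size_tuple.
  rewrite -[cast_ord _ i](splitK _); case: splitP => i' /= hi; rewrite /unsplit.
    by rewrite col_mxEu mxE hi ltn_ord (tnth_nth 0).
  by rewrite col_mxEd mxE hi ltnNge leq_addr /= addKn (tnth_nth 0).
have omegaQuadE (u : (dimQuad n).-tuple Hom) : omegaQuad (map (drho m) u) =
    \det ((\matrix_i mxvec (tnth u i)) *m drho_mx m).
  congr (\det _); apply/row_matrixP => i; rewrite row_mul rowK mul_drho_mx.
  apply/rowP => j; rewrite mxE [LHS]mxE (nth_map 0) ?size_tuple //.
  by rewrite /drho_vec mxvecK [RHS]mxE (tnth_nth 0).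
have key (u : (dimQuad n).-tuple Hom) :
    omegaHom (u ++ t) * frame_det e m = omegaQuad (map (drho m) u).
  by rewrite omegaHomE omegaQuadE -(det_frame dimHomE _ VD VE).
apply: xget_unique => [u|c hc]; first by rewrite -key mulfK.
(* The value picked by [xget] is unique as soon as some u has nonzero [omegaQuad]; the rows dual to
   the differential have determinant 1. *)
have [u hu] : exists u : (dimQuad n).-tuple Hom, omegaQuad (map (drho m) u) != 0.
  have [U [_ [hU _ _]]] := dual_frame d0.
  exists [tuple vec_mx (row i U) | i < dimQuad n]; rewrite omegaQuadE.
  rewrite (_ : \matrix_i _ = U) ?hU ?det1 ?oner_neq0 //.
  by apply/row_matrixP => i; rewrite rowK tnth_mktuple vec_mxK.
apply: (mulfI d0); rewrite divff //; apply: (mulfI hu).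
by rewrite mulrCA -hc mulr1 -key mulrC.
Qed.

End LocalDensityForm.

(** The hypothesis [hF] of Hensel's lemma for [rho]. Moving the base point from y to [x0] changes
    the linear term by a multiple of p^(m+1), and the quadratic remainder is a multiple of
    p^(2m). *)
Lemma rho_vec_linearization (S : comNzRingType) (p : S) n k m
    (x y x0 : 'rV[S]_(n * (k + k))) :
  congr_mod p 1 x x0 -> congr_mod p 1 y x0 -> congr_mod p m x y ->
  congr_mod p m.+1 (rho_vec x - rho_vec y) ((x - y) *m drho_mx (vec_mx x0)).
Proof.
move=> hx hy; have hxy : congr_mod p 1 x y by apply: congr_trans hx (congr_sym hy).
(* 2m >= m + 1 fails at m = 0; there x and y are congruent modulo p anyway, and m = 1 gives more
   than required. *)
wlog m0 : m / (0 < m)%N => [hw|].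
  by case: m => [_|m]; [apply/(congr_le (leqnSn 1))/hw|exact: hw].
move=> [Z hZ]; case: hy => W /(canRL (subrK _)) hW.
exists (Z *m drho_mx (vec_mx W) + p ^+ (2 * m - m.+1) *: rho_vec Z).
have xE : x = y + p ^+ m *: Z by rewrite -hZ addrC subrK.
have dE : drho_mx (vec_mx y) = p *: drho_mx (vec_mx W) + drho_mx (vec_mx x0).
  by rewrite hW linearD linearZ /= drho_mx_linear expr1.
have zE (r a b c : 'rV[S]_(dimQuad n)) : r + (b + a) + c - r - a = b + c.
  by apply/rowP => j; rewrite !mxE; ring.
rewrite {1}xE rho_vecD rho_vecZ hZ dE mulmxDr -scalemxAr -!scalemxAl zE.
rewrite scalerDr !scalerA -exprS -exprD -exprM.
by congr (_ + p ^+ _ *: _); lia.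
Qed.

(** * Charts of the residue classes *)

Section Chart.
Variables (K : padicField) (pi : integerRing K) (kappa : finFieldType)
  (red : {rmorphism integerRing K -> kappa}).
Hypothesis hred : is_residue_field pi red.
Variables (n k : nat).
Hypothesis nk : (n <= k)%N.
Local Notation O := (integerRing K).
Local Notation v := (@pf_v K).

(** [e] is chosen for [A] alone, and the Jacobian at any lift reduces to the one at [A], so it is
    invertible over the integers. The clauses provide the unit density, the existence of the inverse
    chart, and its injectivity and continuity. *)
Lemma primitive_charts (A : 'M[kappa]_(n, k + k)) : row_free A ->
  exists e : 'I_(dimFib n k) -> 'I_(dimHom n k), [/\
    forall X : 'M[O]_(n, k + k), map_mx red X = A ->
      frame_det nk e (map_mx (@ival K) X) != 0
      /\ v (frame_det nk e (map_mx (@ival K) X)) = 0,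
    forall (X0 : 'M[O]_(n, k + k)) t y, map_mx red X0 = A ->
      congr_mod pi 1 (rho_vec (mxvec X0)) t ->
      congr_mod pi 1 (mxvec X0 *m colsub e 1%:M) y ->
      exists X, [/\ map_mx red X = A, rho_vec (mxvec X) = t & mxvec X *m colsub e 1%:M = y] &
    forall m (X Y : 'M[O]_(n, k + k)), map_mx red X = A -> map_mx red Y = A ->
      rho_vec (mxvec X) = rho_vec (mxvec Y) ->
      congr_mod pi m (mxvec X *m colsub e 1%:M) (mxvec Y *m colsub e 1%:M) ->
      congr_mod pi m X Y].
Proof.
move=> /drho_mx_full/(complement_columns (dimHomE nk))[e he].
have {}he : frame_det nk e A != 0 by [].
have congr_vec m (X Y : 'M[O]_(n, k + k)) :
    congr_mod pi m (mxvec X) (mxvec Y) <-> congr_mod pi m X Y.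
  split=> -[Z hZ]; last by exists (mxvec Z); rewrite -linearB hZ linearZ.
  exists (vec_mx Z); apply: (can_inj mxvecK).
  by rewrite linearB hZ linearZ /= vec_mxK.
have redA (X Y : 'M[O]_(n, k + k)) : map_mx red X = A -> map_mx red Y = A ->
    congr_mod pi 1 (mxvec X) (mxvec Y).
  by move=> XA YA; apply/congr_vec/(congr_red hred); rewrite XA YA.
pose F (x : 'rV[O]_(n * (k + k))) := row_mx (rho_vec x) (x *m colsub e 1%:M).
have hF (x0 : 'M[O]_(n, k + k)) m x y : congr_mod pi 1 x (mxvec x0) ->
    congr_mod pi 1 y (mxvec x0) -> congr_mod pi m x y ->
    congr_mod pi m.+1 (F x - F y) ((x - y) *m frame_mx e x0).
  move=> hx hy hxy; rewrite /frame_mx mul_mx_row.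
  have -> : F x - F y = row_mx (rho_vec x - rho_vec y) ((x - y) *m colsub e 1%:M).
    by rewrite mulmxBl /F opp_row_mx add_row_mx.
  have [Z hZ] := rho_vec_linearization hx hy hxy; rewrite mxvecK in hZ.
  exists (row_mx Z 0).
  rewrite opp_row_mx add_row_mx (subrr ((x - y) *m colsub e 1%:M)).
  by rewrite scale_row_mx scaler0 hZ.
have hJ (X : 'M[O]_(n, k + k)) : map_mx red X = A ->
    exists J', frame_mx e X *m J' = 1%:M /\ J' *m frame_mx e X = 1%:M.
  move=> XA; apply: (integral_inverse hred (h := dimHomE nk)).
  by rewrite map_frame_mx XA.
exists e; split=> [X XA|X0 t y XA ht hy|m X Y XA YA XY].
- have := he; rewrite -XA -map_frame_det => /(red_unit hred)[vX _].
  rewrite -map_frame_det vX; split => //.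
  have : frame_det nk e X != 0.
    by apply: contraNneq he => X0; rewrite -XA -map_frame_det X0 rmorph0.
  by rewrite -(inj_eq (@ival_inj K)) rmorph0.
- have [J' [JJ' J'J]] := hJ _ XA.
  have [|x hx] := hensel_surjective hred JJ' J'J (hF X0) (t := row_mx t y).
    case: ht hy => Z hZ [W hW]; exists (row_mx Z W).
    by rewrite opp_row_mx add_row_mx hZ hW scale_row_mx.
  move=> /eq_row_mx[xt xy]; exists (vec_mx x); rewrite vec_mxK; split=> //.
  by rewrite -XA; apply/(congr_red hred)/congr_vec; rewrite vec_mxK.
- have [J' [JJ' J'J]] := hJ _ XA => hXY; apply/congr_vec.
  apply: (hensel_injective JJ' (hF X)) (congr_refl _ _ _) (redA _ _ YA XA) _.
  case: hXY => Z hZ; exists (row_mx 0 Z).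
  by rewrite /F XY opp_row_mx add_row_mx subrr hZ scale_row_mx scaler0.
Qed.

End Chart.

Lemma measure_disjoint_cst d (R : realType) (T : measurableType d)
    (mu : {measure set T -> \bar R}) (I : finType) (A : {set I}) (F : I -> set T) (c : \bar R) :
  (forall i, i \in A -> measurable (F i) /\ mu (F i) = c) ->
  trivIset [set` A] F -> mu (\bigcup_(i in [set` A]) F i) = (#|A|%:R%:E * c)%E.
Proof.
move=> hF tF; rewrite measure_fin_bigcup //; last by move=> i /hF[].
rewrite -(@bigfs _ _ _ _ (index_enum I)) ?index_enum_uniq //; last first.
  by move=> i _; rewrite mem_index_enum.
rewrite (eq_bigr (fun=> c)) => [|i /hF[]//].
by rewrite mule_natl big_const iter_addr addr0.
Qed.

(** * Balls, measurability and Haar measure *)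

Section Balls.
Variables (K : padicField) (pi : integerRing K) (kappa : finFieldType)
  (red : {rmorphism integerRing K -> kappa}).
Hypothesis hred : is_residue_field pi red.
Local Notation O := (integerRing K).
Local Notation v := (@pf_v K).
Let hv : is_valuation v := pf_valuation K.

Lemma map_ival_inj a b : injective (map_mx (@ival K) : 'M[O]_(a, b) -> 'M[K]_(a, b)).
Proof.
move=> X Y /matrixP XY; apply/matrixP => i j; apply: ival_inj.
by have := XY i j; rewrite !mxE.
Qed.

Lemma measurable_pball a b (c : 'M[K]_(a, b)) m :
  measurable (pball c m : set (borel K a b)).
Proof. by apply: sub_sigma_algebra; exists c, m. Qed.

Lemma pball_integral a b (Y : 'M[O]_(a, b)) (m : nat) x :
  pball (map_mx (@ival K) Y) m%:Z x ->
  exists2 X, x = map_mx (@ival K) X & congr_mod pi m X Y.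
Proof.
move=> hx; have h i j : exists z : O, ival z = x i j.
  apply: vge0_ival; rewrite -(subrK (map_mx (@ival K) Y i j) (x i j)).
  apply: vgeD => //; last by rewrite mxE; exact: vge_ival.
  by apply: vge_le (hx i j).
have /choice[X hX] i : exists X, forall j, ival (X j) = x i j.
  by have /choice[X hX] := h i; exists X.
have xX : x = map_mx (@ival K) (\matrix_(i, j) X i j).
  by apply/matrixP => i j; rewrite !mxE hX.
by exists (\matrix_(i, j) X i j) => //; apply/(congr_pball hred); rewrite -xX.
Qed.

(** There are finitely many classes modulo [pi ^+ m], so the set is a finite union of balls. *)
Lemma measurable_congr_stable a b m (S : set 'M[O]_(a, b)) :
  (forall X Y, congr_mod pi m X Y -> S Y -> S X) ->
  measurable (map_mx (@ival K) @` S : set (borel K a b)).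
Proof.
move=> hS; have [w hw] := residue_system hred m.
pose ball (M : 'M[m.-tuple kappa]_(a, b)) := pball (map_mx (@ival K) (map_mx w M)) m%:Z.
have -> : map_mx (@ival K) @` S =
    \bigcup_(M in [set M : 'M[m.-tuple kappa]_(a, b) | S (map_mx w M)]) ball M.
  apply/seteqP; split=> [_ [X SX <-]|x [M SM /pball_integral[X -> XM]]]; last first.
    by exists X => //; apply: hS XM SM.
  have /choice[f hf] i : exists f, forall j, exists z, X i j = w (f j) + pi ^+ m * z.
    by have /choice[f hf] := fun j => hw (X i j); exists f.
  pose M := \matrix_(i, j) f i j : 'M[m.-tuple kappa]_(a, b).
  have XM : congr_mod pi m X (map_mx w M).
    apply/congrP => i j; have [z hz] := hf i j; exists z.
    by rewrite !mxE hz addrAC subrr add0r.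
  by exists M; [exact: hS (congr_sym XM) SX | exact/(congr_pball hred)].
apply: fin_bigcup_measurable => [|M _]; first exact: finite_finset.
exact: measurable_pball.
Qed.

(** The unit polydisc is the disjoint union of f^d translates of the ball, one for each vector of
    residues. *)
Lemma haar_pball (R : realType) d (haar : {measure set (borel K 1 d) -> \bar R}) c :
  is_haar haar -> haar (pball c 1) = (#|kappa|%:R ^- d)%:E.
Proof.
move=> [hT h1].
have haarc (x : 'rV[K]_d) : haar (pball x 1) = haar (pball 0 1).
  rewrite -[RHS](hT x); last exact: measurable_pball.
  congr (haar _); apply/seteqP; split=> [y hy|_ [y hy <-] i j].
    exists (y - x); last by rewrite addrC subrK.
    by move=> i j; have := hy i j; rewrite !mxE subr0.
  by have := hy i j; rewrite !mxE subr0 [x i j + _]addrC addrK.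
have [lift liftK] := residue_section hred.
pose ball (M : 'rV[kappa]_d) : set (borel K 1 d) := pball (map_mx (@ival K) (map_mx lift M)) 1.
have redlift (M : 'rV[kappa]_d) : map_mx red (map_mx lift M) = M.
  by apply/matrixP => i j; rewrite !mxE liftK.
have cover : pball 0 0 = \bigcup_(M in [set` [set: 'rV[kappa]_d]%SET]) ball M.
  apply/seteqP; split=> [x|x [M _ hx] i j].
    rewrite -[X in pball X](map_mx0 (@ival K)) => /(@pball_integral _ _ _ 0)[X -> _].
    exists (map_mx red X); first by rewrite /= inE.
    by apply/(congr_pball hred 1)/(congr_red hred); rewrite redlift.
  have [X -> _] := pball_integral (m := 1) hx.
  by rewrite !mxE subr0; exact: vge_ival.
have := h1; rewrite cover (measure_disjoint_cst (c := haar (pball 0 1))).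
- rewrite cardsT card_mx mul1n haarc.
  have k0 : (#|kappa| ^ d)%:R != 0 :> R.
    by rewrite pnatr_eq0 expn_eq0 negb_and -lt0n (cardD1 0) inE.
  (* Infinite values are excluded since the total volume is 1. *)
  case: (haar _) => [r| |] /=.
  + by move=> [] /(canRL (mulKf k0)) ->; rewrite mulr1 natrX.
  + by rewrite mulry gtr0_sg ?mul1e // lt0r k0 ler0n.
  + by rewrite mulrNy gtr0_sg ?mul1e // lt0r k0 ler0n.
- by move=> M _; split; [exact: measurable_pball | exact: haarc].
- move=> M M' _ _ [x [hM hM']].
  have [X xX /(congr_red hred) XM] := pball_integral (m := 1) hM.
  have [X' xX' /(congr_red hred)] := pball_integral (m := 1) hM'.
  rewrite xX in xX'; rewrite -(map_ival_inj xX').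
  by rewrite XM !redlift.
Qed.

End Balls.

(** * The pieces of the domain of integration and their volumes *)

Section PrimitiveIsometries.
Variables (K : padicField) (pi : integerRing K) (kappa : finFieldType)
  (red : {rmorphism integerRing K -> kappa}).
Hypothesis hred : is_residue_field pi red.
Local Notation O := (integerRing K).
Local Notation v := (@pf_v K).
Let hv : is_valuation v := pf_valuation K.
Variables (L : lmodType O) (n : nat) (b : 'I_n -> L).
Hypothesis hb : is_basis b.
Variable q : L -> O.
Hypothesis hq : is_quadratic q.
Hypothesis hV : nondegenerate_quadratic (qbase (@ival K) b q).
Variable k : nat.

Definition comb (c : 'rV[O]_n) : L := \sum_i c 0 i *: b i.

Lemma combD c d : comb (c + d) = comb c + comb d.
Proof. by rewrite -big_split; apply: eq_bigr => i _; rewrite mxE scalerDl. Qed.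

Lemma combZ a c : comb (a *: c) = a *: comb c.
Proof. by rewrite scaler_sumr; apply: eq_bigr => i _; rewrite mxE scalerA. Qed.

Lemma hyp_mulmx_quadratic (S : comNzRingType) (X : 'M[S]_(n, k + k)) :
  is_quadratic (fun x : 'rV[S]_n => hyp (x *m X)).
Proof.
apply: (@quadratic_comp _ _ _ (@hyp S k) (fun x => x *m X)).
- by move=> x y; rewrite mulmxDl.
- by move=> a x; rewrite scalemxAl.
- exact: hyp_quadratic.
Qed.

Definition isometric (X : 'M[O]_(n, k + k)) : Prop := forall c, hyp (c *m X) = q (comb c).

Lemma isometricP X : isometric X <-> rho_vec (mxvec X) = qvec (q \o comb).
Proof.
split=> [hX|hX]; first by apply: eq_qvec => x; rewrite mxvecK hX.
apply: (@qvec_inj _ n (fun x => hyp (x *m X)) (q \o comb)).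
- exact: hyp_mulmx_quadratic.
- exact: quadratic_comp combD combZ hq.
- by rewrite -hX /rho_vec mxvecK.
Qed.

Lemma prim_isometriesP m : prim_isometries red b q k m <->
  exists X : 'M[O]_(n, k + k), [/\ isometric X,
    injective (fun x : 'rV[kappa]_n => x *m map_mx red X) & m = map_mx (@ival K) X].
Proof.
split=> [[phi [hphi iphi mE]]|[X [hX iX mE]]].
  exists (linear_mx b phi); split=> // c; rewrite -hphi; congr (hyp _).
  rewrite /comb linear_sum mulmx_sum_row; apply: eq_bigr => i _.
  by rewrite linearZ /= rowK.
(* A matrix is turned into a map on L through coordinates in the basis; their uniqueness makes the
   map linear. *)
have /choice[c hc] x : exists c : 'rV[O]_n, x = comb c.
  by have [c [-> _]] := hb x; exists c.
have combI : injective comb.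
  move=> d d' dd'; have [e [_ eU]] := hb (comb d).
  by rewrite -(eU d) // -(eU d').
pose phi x := c x *m X.
have phi_linear : linear phi.
  move=> a x y; rewrite /phi scalemxAl -mulmxDl; congr (_ *m _).
  by apply: combI; rewrite combD combZ -!hc.
pose Phi : {linear L -> 'rV[O]_(k + k)} :=
  HB.pack phi (GRing.isLinear.Build _ _ _ _ phi phi_linear).
have XE : linear_mx b phi = X.
  apply/row_matrixP => i; rewrite rowK /phi rowE; congr (_ *m _).
  apply: combI; rewrite -hc /comb (bigD1 i) //= mxE !eqxx scale1r.
  rewrite big1 ?addr0 // => j /negbTE ji; by rewrite mxE ji scale0r.
exists Phi; split=> [x||]; rewrite ?XE //.
by rewrite [RHS](congr1 q (hc x)) -hX.
Qed.

Lemma red_isometric X : isometric X -> forall x : 'rV[kappa]_n,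
  hyp (x *m map_mx red X) = qbase red b q x.
Proof.
move=> hX x; have [lift liftK] := residue_section hred.
have -> : x = map_mx red (map_mx lift x) by apply/matrixP => i j; rewrite !mxE liftK.
by rewrite qbaseP // -map_mxM -map_hyp hX.
Qed.

(** Vectors over K, unlike vectors over [kappa], need not come from integral ones, so the two forms
    are compared by their coefficients. *)
Lemma ival_isometric X : isometric X -> forall x : 'rV[K]_n,
  hyp (x *m map_mx (@ival K) X) = qbase (@ival K) b q x.
Proof.
move=> hX; apply: (@qvec_inj _ n (fun x => hyp (x *m map_mx (@ival K) X))).
- exact: hyp_mulmx_quadratic.
- exact: qeval_quadratic.
- rewrite -(map_qvec (r := @ival K) (q := fun c => hyp (c *m X))).
    by apply: map_qvec => c; rewrite hX (qbaseP (@ival K)).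
  by move=> c; rewrite map_hyp map_mxM.
Qed.

Lemma prim_isometries_modP A : A \in prim_isometries_mod red b q k ->
  row_free A /\ rho_vec (mxvec A) = map_mx red (qvec (q \o comb)).
Proof.
rewrite inE => /andP[/injectiveP iA /forallP hA]; split.
  by apply: inj_row_free => x xA; apply: iA; rewrite xA mul0mx.
rewrite (map_qvec (q' := qbase red b q)) => [|x]; last by rewrite qbaseP.
by apply: eq_qvec => x; rewrite mxvecK; exact/eqP/hA.
Qed.

Definition isometries_over (A : 'M[kappa]_(n, k + k)) : set 'M[K]_(n, k + k) :=
  map_mx (@ival K) @` [set X | map_mx red X = A /\ isometric X].

Lemma prim_isometries_partition : prim_isometries red b q k =
  \bigcup_(A in [set` prim_isometries_mod red b q k]) isometries_over A.
Proof.
apply/seteqP; split=> [m /prim_isometriesP[X [hX iX ->]]|m [A hA [X [XA hX] <-]]].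
  exists (map_mx red X); last by exists X.
  rewrite /= inE; apply/andP; split; first exact/injectiveP.
  by apply/forallP => x; rewrite (red_isometric hX).
apply/prim_isometriesP; exists X; split=> //.
by move: hA; rewrite /= inE -XA => /andP[/injectiveP].
Qed.

Lemma trivIset_isometries_over D : trivIset D isometries_over.
Proof.
by move=> A B _ _ [_ [[X [<- _] <-] [Y [<- _] /map_ival_inj ->]]].
Qed.

(** The isometry equation holds when it holds modulo every [pi ^+ m], and each truncated equation
    cuts out a finite union of balls. *)
Lemma measurable_isometries_over A : measurable (isometries_over A : set (borel K n (k + k))).
Proof.
pose S m : set 'M[O]_(n, k + k) :=
  [set X | map_mx red X = A /\ congr_mod pi m (rho_vec (mxvec X)) (qvec (q \o comb))].
have -> : isometries_over A = \bigcap_m (map_mx (@ival K) @` S m).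
  apply/seteqP; split=> [_ [X [XA hX] <-] m _|x hx].
    by exists X => //; split=> //; move/isometricP: hX => ->; exact: congr_refl.
  have [X [XA _] Xx] := hx 0%N I; exists X => //; split=> //.
  apply/isometricP/(congr_separated hred) => m.
  by have [Y [_ hY]] := hx m I; rewrite -Xx => /map_ival_inj <-.
(* Level m + 1 instead of m, so that the reduction [A] is preserved also for m = 0. *)
apply: bigcapT_measurable => m; apply: (measurable_congr_stable hred (m := m.+1)).
move=> X Y XY [YA hY]; split.
  by rewrite -YA; apply/(congr_red hred)/(congr_le _ XY).
apply: congr_trans hY; have [Z /(canRL (subrK _)) ->] := congr_le (leqnSn m) XY.
rewrite addrC linearD linearZ /= rho_vecD rho_vecZ -scalemxAl.
exists (mxvec Z *m drho_mx (vec_mx (mxvec Y)) + pi ^+ m *: rho_vec (mxvec Z)).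
by rewrite scalerDr scalerA -expr2 addrAC [_ + _ *: _ - _]addrAC subrr add0r.
Qed.

Hypothesis nk : (n <= k)%N.

Lemma measure_isometries_over (R : realType)
    (haar : {measure set (borel K 1 (dimFib n k)) -> \bar R}) (hhaar : is_haar haar)
    (mu : {measure set (borel K n (k + k)) -> \bar R})
    (hmu : is_ld_measure #|kappa| haar (qbase (@ival K) b q) mu) A :
  A \in prim_isometries_mod red b q k ->
  mu (isometries_over A) = (#|kappa|%:R ^- dimFib n k)%:E.
Proof.
move=> /prim_isometries_modP[fA rA].
have [e [edet esurj einj]] := primitive_charts hred nk fA.
have [lift liftK] := residue_section hred.
pose X0 := map_mx lift A.
have X0A : map_mx red X0 = A by apply/matrixP => i j; rewrite !mxE liftK.
pose y0 := mxvec X0 *m colsub e 1%:M.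
pose D := pball (map_mx (@ival K) y0) 1.
(* Any lift [X0] solves the isometry equation modulo [pi], as [A] is isometric; Hensel's lemma
   corrects it to an isometry with prescribed coordinates y. The value 0 off [D] only makes the
   choice total. *)
have /choice[s0 hs0] y : exists X : 'M[O]_(n, k + k), D y ->
    [/\ map_mx red X = A, isometric X & map_mx (@ival K) (mxvec X *m colsub e 1%:M) = y].
  have [Dy|] := pselect (D y); last by exists 0.
  have [y' -> y'0] := pball_integral (m := 1) hred Dy.
  have [||X [XA hX Xy]] := esurj X0 (qvec (q \o comb)) y' X0A.
  - by apply/(congr_red hred); rewrite map_rho_vec map_mxvec X0A rA.
  - exact: congr_sym.
  - by exists X => _; split=> //; [exact/isometricP | rewrite Xy].
pose s y := map_mx (@ival K) (s0 y).
have sdet y : D y -> frame_det nk e (s y) != 0 /\ v (frame_det nk e (s y)) = 0.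
  by move=> /hs0[XA _ _]; exact: edet.
have /choice[t ht] y : exists t : (dimFib n k).-tuple 'M[K]_(n, k + k),
    D y -> coord_frame e (s y) t.
  have [Dy|] := pselect (D y); last by exists [tuple 0 | i < dimFib n k].
  by have [t ht] := coord_frame_exists (sdet y Dy).1; exists t.
have sD : s @` D = isometries_over A.
  apply/seteqP; split=> [_ [y /hs0[XA hX _] <-]|_ [X [XA hX] <-]]; first by exists (s0 y).
  pose y := map_mx (@ival K) (mxvec X *m colsub e 1%:M).
  have Dy : D y.
    apply/(congr_pball hred 1)/congr_mulr/(congr_red hred).
    by rewrite !map_mxvec XA X0A.
  have [YA hY Yy] := hs0 y Dy; exists y; first exact: Dy.
  rewrite /s; suff -> : s0 y = X by [].
  apply: (congr_separated hred) => m; apply: (einj m _ _ YA XA).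
    by move/isometricP: hY => ->; exact/esym/isometricP.
  by rewrite (map_ival_inj Yy); exact: congr_refl.
rewrite -sD (hmu e D s t).
- rewrite (eq_integral (cst 1%:E)) => [|y /set_mem Dy]; last first.
    have [d0 vd] := sdet y Dy.
    rewrite (omega_ldE d0 (ht y Dy)) /pabs invr_eq0 (negbTE d0) valV // vd.
    by rewrite !oppr0 expr0z.
  rewrite integral_cst; last exact: measurable_pball.
  by rewrite mul1e (haar_pball hred _ hhaar).
(* [D] is open because every point of an ultrametric ball is a centre. *)
- move=> y Dy; exists 1 => z hz i j.
  by rewrite -(subrKA (y i j)); apply: vgeD; [exact: hv | exact: hz | exact: Dy].
- move=> y Dy m; exists `|m|%N => z Dz yz.
  have [YA hY Yy] := hs0 y Dy; have [ZA hZ Zz] := hs0 z Dz.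
  have YZ : congr_mod pi `|m| (s0 z) (s0 y).
    apply: (einj _ _ _ ZA YA).
      by move/isometricP: hZ => ->; exact/esym/isometricP.
    by apply/(congr_pball hred); rewrite Yy Zz.
  move=> i j; apply: (@vge_le _ _ m `|m|%N); first exact: lez_abs.
  by have /(congr_pball hred) := YZ; apply.
- move=> y Dy; have [YA hY Yy] := hs0 y Dy; split; last exact: ht.
    split; last exact: ival_isometric.
    (* Isometries of a nondegenerate form are injective: a vector in the kernel is orthogonal to all
       of V. *)
    move=> x x' /= xx'; apply/eqP; rewrite -subr_eq0; apply/eqP/hV => z.
    have xx0 : (x - x') *m s y = 0 by rewrite mulmxBl xx' subrr.
    rewrite /polar -!(ival_isometric hY) mulmxDl xx0 add0r.
    by rewrite (q0 (hyp_quadratic _ k)) subr0 subrr.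
  by rewrite coordsE -[RHS]Yy map_mxM map_mxvec map_mxsub map_mx1.
Qed.

End PrimitiveIsometries.

Theorem theorem3p12 (R : realType) (K : padicField)
  (pi : integerRing K) (kappa : finFieldType)
  (red : {rmorphism integerRing K -> kappa})
  (hred : is_residue_field pi red)
  (L : lmodType (integerRing K)) (n : nat)
  (b : 'I_n -> L) (hb : is_basis b)
  (q : L -> integerRing K) (hq : is_quadratic q)
  (hV : nondegenerate_quadratic (qbase (@ival K) b q))
  (k : nat) (hk : (n <= k)%N)
  (haar : {measure set (borel K 1 (dimFib n k)) -> \bar R})
  (hhaar : is_haar haar)
  (mu : {measure set (borel K n (k + k)) -> \bar R})
  (hmu : is_ld_measure #|kappa| haar (qbase (@ival K) b q) mu) :
  mu (prim_isometries red b q k) =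
    (#|kappa|%:R ^- (2 * k * n - (n ^ 2 + n)./2)
      * #|prim_isometries_mod red b q k|%:R)%:E.
Proof.
have -> : (2 * k * n - (n ^ 2 + n)./2)%N = dimFib n k.
  by rewrite /dimFib /dimHom dimQuadE addnn -mul2n mulnC.
rewrite (prim_isometries_partition hred hb hq).
rewrite (measure_disjoint_cst (c := (#|kappa|%:R ^- dimFib n k)%:E)).
- by rewrite -EFinM mulrC.
- move=> A hA; split; first exact: (measurable_isometries_over hred b hq).
  exact: (measure_isometries_over hred hq hV hk hhaar hmu).
- exact: trivIset_isometries_over.
Qed.
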